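(* Suppose that $G$ satisfies: (i) there is $0<\alpha<1$ such that for $m$-almost every $\underline{x}\in\Sigma_A^+$ one has $d(G(\underline{x},y_1),G(\underline{x},y_2))\le \alpha\, d(y_1,y_2)$ for all $y_1,y_2\in K$; (ii) for every $y\in K$ there is $k_y\ge0$ with $d(G(\underline{x}^1,y),G(\underline{x}^2,y))\le k_y\,d_\theta(\underline{x}^1,\underline{x}^2)$ for all $\underline{x}^1,\underline{x}^2\in\Sigma_A^+$, and $H:=\sup_{y\in K}k_y<\infty$. Let $\mu_0$ be the unique $F$-invariant probability measure in $S^\infty$. Then $\mu_0\in\mathcal{L}_\theta^+$ and $$|\mu_0|_\theta\le\frac{C_1}{1-\theta},$$ where $C_1>0$ is a constant.
   Context: Base. Let $A$ be an aperiodic $N\times N$ matrix with entries in $\{0,1\}$ (some power of $A$ has all entries positive), $\Sigma_A^+=\{\underline{x}=(x_i)_{i\ge 0}: x_i\in\{1,\dots,N\},\ A_{x_ix_{i+1}}=1\ \forall i\}$, with the metric $d_\theta(\underline{x},\underline{y})=\sum_{i\ge0}\theta^i(1-\delta(x_i,y_i))$, where $\theta\in(0,1)$ is fixed and $\delta(a,b)=1$ if $a=b$, $0$ otherwise. Let $\sigma$ be the left shift on $\Sigma_A^+$ and $m$ a Markov measure associated to $(\Sigma_A^+,\sigma)$ (the $\sigma$-invariant probability given by a stochastic matrix $(p_{ij})$ with $p_{ij}>0$ iff $A_{ij}=1$ and its stationary probability vector). For $\varphi:\Sigma_A^+\to\mathbb{R}$ let $|\varphi|_\theta$ be its Lipschitz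 constant with respect to $d_\theta$, $\mathcal{F}_\theta(\Sigma_A^+)=\{\varphi:|\varphi|_\theta<\infty\}$, $\|\varphi\|_\theta=\|\varphi\|_\infty+|\varphi|_\theta$. Skew product. $(K,d)$ is a compact metric space with $\operatorname{diam}(K)=1$; $\Sigma:=\Sigma_A^+\times K$; $G:\Sigma\to K$ is measurable (Borel) and $F:\Sigma\to\Sigma$ is $F(\underline{x},y)=(\sigma(\underline{x}),G(\underline{x},y))$. Put $\gamma_{\underline{x}}=\{\underline{x}\}\times K$, $\pi_1(\underline{x},y)=\underline{x}$, $\pi_2(\underline{x},y)=y$, and let $\pi_1^*$, $\pi_2^*$ denote push-forward of measures. Spaces of measures. For a finite signed Borel measure $\nu$ on a compact metric space $X$, $\|\nu\|_W=\sup\{|\int g\,d\nu| : g:X\to\mathbb{R}\text{ Lipschitz with constant}\le1,\ \|g\|_\infty\le1\}$. Let $\mathcal{AB}$ be the set of finite signed Borel measures $\mu$ on $\Sigma$, with Jordan decomposition $\mu=\mu^+-\mu^-$, such that $\pi_1^*\mu^+\ll m$ and $\pi_1^*\mu^-\ll m$; write $\phi_1=\frac{d(\pi_1^*\mu)}{dm}$. For positive $\mu\in\mathcal{AB}$ a disintegration $\omega=(\{\mu_{\gamma_{\underline{x}}}\},\phi_1)$ along the leaves consists of $\phi_1$ and probabilities on $\Sigma$ with $\mu_{\gamma_{\underline{x}}}(\gamma_{\underline{x}})=1$ for $\phi_1m$-a.e. $\underline{x}$, $\underline{x}\mapsto\mu_{\gamma_{\underline{x}}}(E)$ measurable, and $\mu(E)=\int\mu_{\gamma_{\underline{x}}}(E)\phi_1(\underline{x})\,dm(\underline{x})$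 for all measurable $E\subset\Sigma$. The restriction of positive $\mu$ to $\gamma_{\underline{x}}$ is the positive measure on $K$ given by $\mu|_{\gamma_{\underline{x}}}(B)=\phi_1(\underline{x})\,\mu_{\gamma_{\underline{x}}}(\pi_2^{-1}(B))$ (zero where $\phi_1(\underline{x})=0$); for signed $\mu\in\mathcal{AB}$, $\mu|_{\gamma_{\underline{x}}}:=\mu^+|_{\gamma_{\underline{x}}}-\mu^-|_{\gamma_{\underline{x}}}$. Set $\|\mu\|_\infty=\operatorname{ess\,sup}_{\underline{x}}\|\mu|_{\gamma_{\underline{x}}}\|_W$ (with respect to $m$), $\mathcal{L}^\infty=\{\mu\in\mathcal{AB}:\|\mu\|_\infty<\infty\}$, $S^\infty=\{\mu\in\mathcal{L}^\infty:\phi_1\in\mathcal{F}_\theta(\Sigma_A^+)\}$. Under hypothesis (i) there is a unique $F$-invariant probability measure in $S^\infty$. Lipschitz measures. For a positive $\mu\in\mathcal{AB}$ and a disintegration $\omega$ of $\mu$ let $\Gamma_\mu^\omega(\underline{x})=\mu|_{\gamma_{\underline{x}}}$ be the associated path of positive measures on $K$ (defined $m$-a.e.), and let $|\mu|_\theta^\omega=\operatorname{ess\,sup}_{\underline{x}^1\neq\underline{x}^2}\frac{\|\Gamma_\mu^\omega(\underline{x}^1)-\Gamma_\mu^\omega(\underline{x}^2)\|_W}{d_\theta(\underline{x}^1,\underline{x}^2)}$, the essential supremum over pairs being with respect to $m$ (i.e. $m\times m$). Set $|\mu|_\theta=\inf_\omega|\mu|_\theta^\omega$ over all disintegrations $\omega$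 of $\mu$, and $\mathcal{L}_\theta^+=\{\mu\in\mathcal{AB}:\mu\ge0,\ |\mu|_\theta<\infty\}$. *)

(* Defs.v *)
From HB Require Import structures.
From mathcomp Require Import all_boot all_order all_algebra.
From mathcomp Require Import all_classical all_reals all_analysis.
From mathcomp Require Import measurable_realfun ess_sup_inf.

Set Implicit Arguments.
Unset Strict Implicit.
Unset Printing Implicit Defensive.
Import Order.TTheory GRing.Theory Num.Theory.
Import numFieldNormedType.Exports.
Local Open Scope classical_set_scope.
Local Open Scope ring_scope.

Record subshift (R : realType) := Subshift {
  nsym : nat ;
  trans : 'M[nat]_nsym ;
  theta : R ;
  nsym_gt0 : (0 < nsym)%N ;
  trans01 : forall i j, trans i j = 0%N \/ trans i j = 1%N ;
  (* [0 < n] matters for [nsym = 1], where [trans ^+ 0] is already positive. *)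
  trans_aperiodic : exists2 n, (0 < n)%N & forall i j, (0 < (trans ^+ n) i j)%N ;
  theta_gt0 : 0 < theta ;
  theta_lt1 : theta < 1 }.

Record shift_space (R : realType) (S : subshift R) := ShiftSpace {
  coord :> nat -> 'I_(nsym S) ;
  coordP : forall i, trans S (coord i) (coord i.+1) = 1%N }.

Section shift_space_theory.
Context {R : realType} (S : subshift R).
Implicit Types x y z : shift_space S.

Lemma shift_space_eq x y : (forall i, x i = y i) -> x = y.
Proof.
case: x y => [x xP] [y yP] /= xy.
have e : x = y by apply/funext.
by case: _ / e yP {xy} => yP; congr ShiftSpace; exact: Prop_irrelevance.
Qed.

Lemma shift_subproof x (i : nat) : trans S (x i.+1) (x i.+2) = 1%N.
Proof. exact: coordP. Qed.

Definition shift x : shift_space S := ShiftSpace (shift_subproof x).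

Lemma next_symbol (i : 'I_(nsym S)) : exists j, trans S i j = 1%N.
Proof.
apply: contrapT => /forallNP nA.
have A0 j : trans S i j = 0%N by case: (trans01 i j) => // /nA.
have [[//|n] _ /(_ i i)] := trans_aperiodic S.
by rewrite exprS mxE big1 // => j _; rewrite A0 mul0r.
Qed.

Let first_symbol : 'I_(nsym S) := Ordinal (nsym_gt0 S).
Let next (i : 'I_(nsym S)) := sval (cid (next_symbol i)).

Lemma shift_space_point_subproof (i : nat) :
  trans S (iter i next first_symbol) (iter i.+1 next first_symbol) = 1%N.
Proof. exact: svalP (cid (next_symbol _)). Qed.

Definition shift_space_point : shift_space S :=
  ShiftSpace shift_space_point_subproof.

Definition dtheta x y : R :=
  limn (series (fun i => theta S ^+ i * (x i != y i)%:R)).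

Let dterm_ge0 x y i : 0 <= theta S ^+ i * (x i != y i)%:R.
Proof. by rewrite mulr_ge0 ?exprn_ge0 // ltW ?theta_gt0. Qed.

Lemma is_cvg_dtheta x y :
  cvgn (series (fun i => theta S ^+ i * (x i != y i)%:R)).
Proof.
apply: (@series_le_cvg _ _ (geometric 1 (theta S))).
- exact: dterm_ge0.
- by move=> i; rewrite /= mul1r exprn_ge0 // ltW ?theta_gt0.
- move=> i; rewrite /= mul1r ler_piMr ?exprn_ge0 ?(ltW (theta_gt0 S)) //.
  by case: (_ != _).
- by apply: is_cvg_geometric_series; rewrite ger0_norm ?theta_lt1 // ltW ?theta_gt0.
Qed.

Lemma dthetaxx x : dtheta x x = 0.
Proof.
rewrite /dtheta (_ : series _ = fun=> 0) ?lim_cst //.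
by apply/funext => n; rewrite /series /= big1 // => i _; rewrite eqxx mulr0.
Qed.

Lemma dtheta_positivity x y : dtheta x y = 0 -> x = y.
Proof.
move=> d0; apply: shift_space_eq => i; apply/eqP/negPn/negP => xy.
have : series (fun i => theta S ^+ i * (x i != y i)%:R) i.+1 <= 0.
  rewrite -d0; apply: nondecreasing_cvgn_le; last exact: is_cvg_dtheta.
  by apply: nondecreasing_series => k _ _; exact: dterm_ge0.
rewrite /series /= big_nat_recr //= xy mulr1 leNgt => /negP; apply.
by rewrite ltr_wpDl ?exprn_gt0 ?theta_gt0 // sumr_ge0 // => k _; exact: dterm_ge0.
Qed.

Lemma dtheta_sym x y : dtheta x y = dtheta y x.
Proof.
congr (limn (series _)); apply/funext => i.
by rewrite eq_sym.
Qed.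

Lemma dtheta_triangle y x z : dtheta x z <= dtheta x y + dtheta y z.
Proof.
rewrite /dtheta -limD; [|exact: is_cvg_dtheta..].
apply: ler_lim; [exact: is_cvg_dtheta| |].
  by apply: is_cvgD; exact: is_cvg_dtheta.
apply: nearW => n.
rewrite -[leRHS]/(series _ n + series _ n) /series /= -big_split /=.
apply: ler_sum => i _.
rewrite -mulrDr ler_wpM2l ?exprn_ge0 ?(ltW (theta_gt0 S)) // -natrD ler_nat.
by case: (eqVneq (x i) (y i)) => [->|_] //=; case: (x i != z i).
Qed.

HB.instance Definition _ := gen_eqMixin (shift_space S).
HB.instance Definition _ := gen_choiceMixin (shift_space S).
HB.instance Definition _ := isPointed.Build (shift_space S) shift_space_point.
HB.instance Definition _ := isMetric.Build R (shift_space S)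
  dthetaxx dtheta_positivity dtheta_sym dtheta_triangle.

End shift_space_theory.

(* Library sigma-algebras live on pointed types; a fibre of diameter 1 is
   nonempty, so asking for a base point is no restriction. *)
#[short(type="pmetricType")]
HB.structure Definition PointedMetric (R : numDomainType) :=
  { T of Pointed T & Metric R T }.

Notation borel X := (g_sigma_algebraType (@open X)).


Section charges.
Local Open Scope ereal_scope.
Context d (T : measurableType d) {R : realType}.
Variable nu : {charge set T -> \bar R}.

(* The Jordan parts do not depend on the Hahn decomposition chosen here. *)
Let hahn := cid (svalP (cid (Hahn_decomposition nu))).

Definition charge_pos : {finite_measure set T -> \bar R} :=
  jordan_pos (svalP hahn).
Definition charge_neg : {finite_measure set T -> \bar R} :=
  jordan_neg (svalP hahn).

Definition charge_integral (g : T -> R) : \bar R :=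
  \int[charge_pos]_y (g y)%:E - \int[charge_neg]_y (g y)%:E.

End charges.

Section Wnorm.
Local Open Scope ereal_scope.
Context {R : realType} (X : pmetricType R).

Definition Wtest : set (X -> R) :=
  [set g | (forall y1 y2, `|g y1 - g y2| <= mdist y1 y2)%R /\
           (forall y, `|g y| <= 1)%R].

Definition Wnorm (nu : {charge set (borel X) -> \bar R}) : \bar R :=
  ereal_sup [set `|charge_integral nu g| | g in Wtest].

End Wnorm.

Definition diam {R : realType} (X : pmetricType R) : R :=
  sup [set mdist y1 y2 | y1 in [set: X] & y2 in [set: X]].

Section markov.
Context {R : realType} (S : subshift R).

(* [q] is read as a row vector: stationarity is [q p = q]. *)
Definition stochastic_data (p : 'M[R]_(nsym S)) (q : 'rV[R]_(nsym S)) : Prop :=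
  [/\ (forall i j, 0 <= p i j) /\ (forall i, \sum_j p i j = 1),
      forall i j, 0 < p i j <-> trans S i j = 1%N,
      (forall i, 0 <= q 0 i) /\ \sum_i q 0 i = 1 &
      q *m p = q].

Definition markov_measure (p : 'M[R]_(nsym S)) (q : 'rV[R]_(nsym S))
    (m : probability (borel (shift_space S)) R) : Prop :=
  stochastic_data p q /\
  forall (n : nat) (w : nat -> 'I_(nsym S)),
    m [set x | forall i, (i <= n)%N -> x i = w i] =
    (q 0 (w 0%N) * \prod_(i < n) p (w i) (w i.+1))%:E.

Definition Ftheta (phi : shift_space S -> R) : Prop :=
  exists L : R, forall x y, `|phi x - phi y| <= L * mdist x y.

End markov.

(* The product sigma-algebra: it is the Borel one of the product, both factors
   being second countable when the fibre is compact. *)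
Notation skew_space S K := (borel (shift_space S) * borel K)%type.

Section fibre_marginal.
Local Open Scope ereal_scope.
Context {R : realType} {S : subshift R} {K : pmetricType R}.
Variable nu : {charge set (skew_space S K) -> \bar R}.

Definition fibre_marginal : set (borel K) -> \bar R := pushforward nu snd.

Let nu' : {charge set (borel K) -> \bar R}.
Proof. refine (pushforward nu snd); exact: measurable_snd. Defined.

Let fibre_marginal0 : fibre_marginal set0 = 0.
Proof. exact: (charge0 nu'). Qed.

Let fibre_marginal_fin A : measurable A -> fibre_marginal A \is a fin_num.
Proof. exact: (fin_num_measure nu'). Qed.

Let fibre_marginal_sigma_additive : semi_sigma_additive fibre_marginal.
Proof. exact: (@charge_semi_sigma_additive _ _ _ nu'). Qed.

HB.instance Definition _ := isCharge.Build _ _ _ fibre_marginal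
  fibre_marginal0 fibre_marginal_fin fibre_marginal_sigma_additive.

End fibre_marginal.

Section measure_spaces.
Local Open Scope ereal_scope.
Context {R : realType} {S : subshift R} {K : pmetricType R}.
Variable m : probability (borel (shift_space S)) R.

Definition AB (mu : {charge set (skew_space S K) -> \bar R}) : Prop :=
  pushforward (charge_pos mu) fst `<< m /\ pushforward (charge_neg mu) fst `<< m.

Definition base_density (mu : set (skew_space S K) -> \bar R)
    (phi : shift_space S -> R) : Prop :=
  forall E : set (borel (shift_space S)), measurable E ->
    pushforward mu fst E = \int[m]_(x in E) (phi x)%:E.

(* [dis_phi] ranges over the nonnegative versions of the density, which is only
   determined up to [m]-null sets. [dis_leaf_supp] is almost-everywhere validity
   for the measure of density [dis_phi] with respect to [m]. *)
Record disintegration (mu : set (skew_space S K) -> \bar R) := Disintegration {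
  dis_phi : borel (shift_space S) -> R ;
  dis_leaf : borel (shift_space S) -> probability (skew_space S K) R ;
  dis_phi_measurable : measurable_fun [set: borel (shift_space S)] dis_phi ;
  dis_phi_ge0 : forall x, (0 <= dis_phi x)%R ;
  dis_phi_density : base_density mu dis_phi ;
  dis_leaf_measurable : forall E, measurable E ->
    measurable_fun [set: borel (shift_space S)] (dis_leaf ^~ E) ;
  dis_leaf_supp : {ae m, forall x, dis_phi x != 0%R ->
    dis_leaf x [set z | z.1 = x] = 1} ;
  disE : forall E, measurable E ->
    mu E = \int[m]_x (dis_leaf x E * (dis_phi x)%:E) }.

Definition leaf_restr (mu : set (skew_space S K) -> \bar R)
    (w : disintegration mu) (x : shift_space S) :
    {charge set (borel K) -> \bar R} :=
  cscale (dis_phi w x)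
    (fibre_marginal (charge_of_finite_measure (dis_leaf w x))).

Definition charge_sub (n1 n2 : {charge set (borel K) -> \bar R}) :
    {charge set (borel K) -> \bar R} := cadd n1 (copp n2).

(* Disintegrations are [m]-a.e. unique: the infimum picks the common value, and
   is [+oo] when there is no disintegration. *)
Definition norm_infty (mu : {charge set (skew_space S K) -> \bar R}) : \bar R :=
  ereal_inf
    [set ess_sup m
       (fun x => Wnorm (charge_sub (leaf_restr wp x) (leaf_restr wm x)))
    | wp in [set: disintegration (charge_pos mu)]
    & wm in [set: disintegration (charge_neg mu)]].

Definition Linfty (mu : {charge set (skew_space S K) -> \bar R}) : Prop :=
  AB mu /\ norm_infty mu < +oo.

Definition Sinfty (mu : {charge set (skew_space S K) -> \bar R}) : Prop :=
  Linfty mu /\ exists2 phi, Ftheta phi & base_density mu phi.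

(* On the diagonal [mdist] vanishes, [0^-1 = 0] and the quotient is 0, so
   diagonal pairs do not contribute. *)
Definition path_lip (mu : set (skew_space S K) -> \bar R)
    (w : disintegration mu) : \bar R :=
  ess_sup (m \x m) (fun z =>
    Wnorm (charge_sub (leaf_restr w z.1) (leaf_restr w z.2)) *
    ((mdist (z.1 : shift_space S) z.2)^-1)%:E).

Definition lip_theta (mu : set (skew_space S K) -> \bar R) : \bar R :=
  ereal_inf [set path_lip w | w in [set: disintegration mu]].

Definition Ltheta_pos (mu : {charge set (skew_space S K) -> \bar R}) : Prop :=
  [/\ AB mu, forall E, measurable E -> 0 <= mu E & lip_theta mu < +oo].

End measure_spaces.

Section skew_product.
Context {R : realType} {S : subshift R} {K : pmetricType R}.

Definition skew (G : skew_space S K -> borel K) (z : skew_space S K) :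
  skew_space S K := (shift z.1, G z).

Definition invariant_measure (G : skew_space S K -> borel K)
    (mu : set (skew_space S K) -> \bar R) : Prop :=
  forall E, measurable E -> pushforward mu (skew G) E = mu E.

Definition fibre_contraction (m : probability (borel (shift_space S)) R)
    (G : skew_space S K -> borel K) (alpha : R) : Prop :=
  {ae m, forall x, forall y1 y2 : K,
    mdist (G (x, y1) : K) (G (x, y2)) <= alpha * mdist y1 y2}.

Definition base_lipschitz (G : skew_space S K -> borel K) (k : K -> R) : Prop :=
  forall y : K, 0 <= k y /\
    forall x1 x2 : shift_space S,
      mdist (G (x1, y) : K) (G (x2, y)) <= k y * mdist x1 x2.

End skew_product.

(* Main.v *)
Require Import Defs.
From HB Require Import structures.
From mathcomp Require Import all_boot all_order all_algebra.
From mathcomp Require Import all_classical all_reals all_analysis.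
From mathcomp Require Import measurable_realfun ess_sup_inf.
From mathcomp Require Import giry ring lra.
From mathcomp Require finmap.
Set Implicit Arguments.
Unset Strict Implicit.
Unset Printing Implicit Defensive.
Import Order.TTheory GRing.Theory Num.Theory.
Import numFieldNormedType.Exports.
Local Open Scope classical_set_scope.
Local Open Scope ring_scope.
(* Makes [shift] the left shift of sequences again, not a translation. *)
Import Defs.

(** The base marginal of [mu0] is shift-invariant with a Lipschitz density.
    The density is fixed by the transfer operator of the Markov measure [m],
    which averages a function over the random symbol that precedes a path.
    Prepending a symbol multiplies distances by [theta], so iterating the
    operator contracts Lipschitz constants on one-cylinders to 0, and the
    density only depends on the initial symbol. It then defines a stationary
    vector of an irreducible stochastic matrix and must be constant
    ([invariant_density_eq1]). So the marginal is [m], and in any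
    disintegration of [mu0] almost every restriction to a leaf is a
    probability.

    Fix a 1-Lipschitz function [h] on the fibre and a point [y0] in it. By
    invariance, the mean of [h] on the leaf through [x] is an average, over the
    pasts of [x] of length [n], of the means of [h] over the [n]-th images of
    the past leaves. These images have diameter at most [alpha ^+ n], so the
    whole leaf may be replaced by the single point [y0]: the leaf mean is within
    [alpha ^+ n] of an explicit function [past_mean] of [x]
    ([leaf_mean_le_past] and [past_le_leaf_mean]), and no regularity of the
    disintegration has to be known beforehand. These functions are Lipschitz on
    one-cylinders uniformly in [n] ([past_mean_loclip]): the dependence of the
    [n]-th image on the base point may grow like [theta ^- n], up to a geometric
    sum of the errors [H] ([iter_skew_base]), and [n] applications of the
    transfer operator gain back [theta ^+ n] ([loclip_iter_transfer]). In the
    limit the leaf means have Lipschitz constant [H / (1 - theta)] on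
    one-cylinders; paths with different initial symbols are at distance at
    least 1, where the trivial bound 2 suffices.

    The exceptional null set depends on [h]. As the fibre is compact, there is
    a countable uniformly dense family of test functions ([dense_Wtest]), hence
    a null set valid for all of them ([leaf_mean_ae_lipschitz]). Taking the
    supremum over test functions bounds the distance between the restrictions
    to two leaves, with [C1 = 2 + `|H|]. *)

(** * The metric of the shift space *)

(** Joins the base point of the shift space with its metric, so that statements
    about pointed metric spaces apply to it. *)
HB.saturate shift_space.

Section shift_metric.
Context {R : realType} (S : subshift R).
Implicit Types x y : shift_space S.

(** The recursion behind all distance estimates: the initial symbols contribute
    0 or 1, the tails are discounted by [theta]. *)
Lemma mdist_shift x y :
  mdist x y = (x 0%N != y 0%N)%:R + theta S * mdist (shift x) (shift y).
Proof.
rewrite -[mdist x y]/(dtheta x y) -[mdist (shift x) _]/(dtheta (shift x) _).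
have cxy := @is_cvg_dtheta _ _ (shift x) (shift y).
apply: cvg_lim => //; rewrite -(cvg_shiftS _).
rewrite (_ : [sequence _]_n = (fun n => (x 0%N != y 0%N)%:R + theta S *
    series (fun i => theta S ^+ i * (shift x i != shift y i)%:R) n)); last first.
  apply/funext => n; rewrite /series /= big_nat_recl //= expr0 mul1r.
  by congr (_ + _); rewrite mulr_sumr; apply: eq_bigr => i _; rewrite exprS mulrA.
by apply: cvgD; [exact: cvg_cst|apply: cvgM => //; exact: cvg_cst].
Qed.

Lemma mdist_shift_le x y : theta S * mdist (shift x) (shift y) <= mdist x y.
Proof. by rewrite [leRHS]mdist_shift lerDr. Qed.

Lemma mdist_ge1 x y : x 0%N != y 0%N -> 1 <= mdist x y.
Proof.
by move=> xy; rewrite mdist_shift xy lerDl mulr_ge0 ?mdist_ge0 // ltW ?theta_gt0.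
Qed.

Lemma mdist_lt1 x y : mdist x y < 1 -> x 0%N = y 0%N.
Proof.
by move=> d1; apply/eqP; apply: contraTT d1 => /mdist_ge1; rewrite -leNgt.
Qed.

Lemma mdist_bound x y : mdist x y <= (1 - theta S)^-1.
Proof.
have t0 := theta_gt0 S; have t1 := theta_lt1 S.
have nt : `|theta S| < 1 by rewrite ger0_norm // ltW.
rewrite -[mdist x y]/(dtheta x y) -[X in _ <= X]mul1r.
rewrite -(cvg_lim (@Rhausdorff R) (cvg_geometric_series (a := 1) nt)).
apply: ler_lim; [exact: is_cvg_dtheta|exact: is_cvg_geometric_series|].
apply: nearW => n; rewrite /series /=; apply: ler_sum => i _.
rewrite /= mul1r ler_piMr ?exprn_ge0 ?(ltW t0) //.
by case: (_ != _).
Qed.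

Lemma mdist_agree x y n : (forall i, (i < n)%N -> x i = y i) ->
  mdist x y <= theta S ^+ n / (1 - theta S).
Proof.
have t0 := ltW (theta_gt0 S).
elim: n x y => [|n IH] x y xy; first by rewrite expr0 mul1r mdist_bound.
rewrite mdist_shift xy // eqxx add0r exprS -mulrA ler_wpM2l //.
by apply: IH => i ni; exact: xy.
Qed.

Lemma agree_of_mdist x y n : mdist x y < theta S ^+ n ->
  forall i, (i <= n)%N -> x i = y i.
Proof.
elim: n x y => [|n IH] x y.
  by rewrite expr0 => /mdist_lt1 xy i; rewrite leqn0 => /eqP ->.
move=> dxy; case=> [_|i ni].
  apply: mdist_lt1; rewrite (lt_le_trans dxy) // exprn_ile1 //.
    by rewrite ltW ?theta_gt0.
  by rewrite ltW ?theta_lt1.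
apply: (IH (shift x) (shift y)) => //.
by rewrite -(ltr_pM2l (theta_gt0 S)) -exprS (le_lt_trans (mdist_shift_le _ _)).
Qed.

Lemma cons_subproof (i : 'I_(nsym S)) x (h : trans S i (x 0%N) = 1%N) n :
  trans S (if n is n'.+1 then x n' else i) (x n) = 1%N.
Proof. by case: n => // n; exact: coordP. Qed.

(** Off the admissible words the value is irrelevant: the transition
    probability that weighs it vanishes. *)
Definition branch (i : 'I_(nsym S)) x : shift_space S :=
  if pselect (trans S i (x 0%N) = 1%N) is left h
  then ShiftSpace (coord := fun n => if n is n'.+1 then x n' else i) (cons_subproof h) else x.

Lemma branchK i x : trans S i (x 0%N) = 1%N -> shift (branch i x) = x.
Proof.
move=> h; rewrite /branch; case: pselect => // h'.
by apply: shift_space_eq.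
Qed.

Lemma branch0 i x : trans S i (x 0%N) = 1%N -> branch i x 0%N = i.
Proof. by move=> h; rewrite /branch; case: pselect. Qed.

Lemma mdist_branch i x y : trans S i (x 0%N) = 1%N -> x 0%N = y 0%N ->
  mdist (branch i x) (branch i y) = theta S * mdist x y.
Proof.
move=> h xy; have h' : trans S i (y 0%N) = 1%N by rewrite -xy.
by rewrite mdist_shift !branch0 // !branchK // eqxx add0r.
Qed.

End shift_metric.

(** * Borel sets and cylinders *)

Section borel_metric.
Context {R : realType}.

Lemma open_mdist (X : metricType R) (U : set X) :
  open U <-> forall x, U x -> exists2 e : R, 0 < e & forall y, mdist x y < e -> U y.
Proof.
rewrite openE; split => h x Ux.
  have /nbhs_ballP[e /= e0 eU] := h x Ux; exists e => // y xy.
  by apply: eU; rewrite ballEmdist.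
have [e e0 eU] := h x Ux; apply/nbhs_ballP; exists e => //= y.
by rewrite ballEmdist /=; exact: eU.
Qed.

Lemma open_borel_measurable (X : ptopologicalType) (U : set X) :
  open U -> measurable (U : set (borel X)).
Proof. by move=> oU; apply: sub_sigma_algebra. Qed.

Lemma measurable_fun_borel (X Y : ptopologicalType) (f : X -> Y) :
  (forall U, open U -> open (f @^-1` U)) ->
  measurable_fun [set: borel X] (f : borel X -> borel Y).
Proof.
move=> fU; apply: (@measurability _ _ (borel X) (borel Y) _ _ (@open Y)) => //.
by move=> _ [U oU <-]; rewrite setTI; apply: open_borel_measurable; exact: fU.
Qed.

Lemma measurable_fun_real (X : pmetricType R) (f : X -> R) :
  (forall x e, 0 < e -> exists2 r : R, 0 < r &
     forall y, mdist x y < r -> `|f x - f y| < e) ->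
  measurable_fun [set: borel X] (f : borel X -> R).
Proof.
move=> fc.
apply: (measurability _ (RGenOInfty.measurableE R)).
move=> _ [_ [a ->] <-]; rewrite setTI; apply: open_borel_measurable.
apply/open_mdist => x /=; rewrite in_itv /= andbT => ax.
have [r r0 fr] := fc x (f x - a) ltac:(by rewrite subr_gt0).
exists r => // y /fr; rewrite in_itv /= andbT ltr_norml => /andP[_].
by rewrite ltrD2l ltrN2.
Qed.

Lemma measurable_lipschitz (X : pmetricType R) (f : X -> R) (L : R) :
  (forall x y, `|f x - f y| <= L * mdist x y) ->
  measurable_fun [set: borel X] (f : borel X -> R).
Proof.
move=> fL; apply: measurable_fun_real => x e e0.
have L0 : 0 < `|L| + 1 by rewrite ltr_wpDl.
exists (e / (`|L| + 1)); first by rewrite divr_gt0.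
move=> y; rewrite ltr_pdivlMr // mulrC => xy; apply: le_lt_trans xy.
rewrite (le_trans (fL x y)) // ler_wpM2r ?mdist_ge0 //.
by rewrite (le_trans (ler_norm _)) // lerDl.
Qed.

Lemma measurable_point (X : pmetricType R) (x : X) :
  measurable ([set x] : set (borel X)).
Proof.
rewrite -[[set x]]setCK; apply: measurableC; apply: open_borel_measurable.
apply/open_mdist => y /= yx; exists (mdist y x).
  by rewrite mdist_gt0; apply/eqP.
by move=> z yz zx; move: yz; rewrite zx ltxx.
Qed.

End borel_metric.

Section cylinders.
Context {R : realType} (S : subshift R).
Local Notation X := (shift_space S).

Definition cyl (s : seq 'I_(nsym S)) : set X := [set x | mkseq x (size s) = s].

Lemma cylP (x y : X) n :
  cyl (mkseq x n) y <-> forall i, (i < n)%N -> y i = x i.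
Proof.
rewrite /cyl /= size_mkseq; split => [e i ni|e].
  by rewrite -(nth_mkseq (x 0%N) y ni) e nth_mkseq.
by apply/eq_in_map => i; rewrite mem_iota; exact: e.
Qed.

Lemma cyl_nil : cyl [::] = setT.
Proof. by apply/seteqP; split. Qed.

Lemma cyl_cons i s : cyl (i :: s) = [set x : X | x 0%N = i /\ cyl s (shift x)].
Proof.
rewrite /cyl /mkseq; apply/seteqP; split => x /=.
  by move=> [-> e]; split => //; rewrite -[RHS]e -[1%N]addn0 iotaDl -map_comp.
move=> [-> e]; congr (_ :: _).
by rewrite -[RHS]e -[1%N]addn0 iotaDl -map_comp.
Qed.

Lemma cyl1 i : cyl [:: i] = [set x : X | x 0%N = i].
Proof. by rewrite cyl_cons cyl_nil; apply/seteqP; split => x //= []. Qed.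

Lemma cyl_open s : open (cyl s).
Proof.
apply/open_mdist => x xs; exists (theta S ^+ size s).
  by rewrite exprn_gt0 // theta_gt0.
move=> y /agree_of_mdist xy; rewrite -xs; apply/cylP => i si.
by rewrite xy // ltnW.
Qed.

Lemma measurable_cyl s : measurable (cyl s : set (borel X)).
Proof. by apply: open_borel_measurable; exact: cyl_open. Qed.

Lemma cyl_small (x : X) e : 0 < e ->
  exists n, forall y, cyl (mkseq x n) y -> mdist x y < e.
Proof.
move=> e0; have t1 := theta_lt1 S; have t0 := theta_gt0 S.
have c0 : 0 < 1 - theta S by rewrite subr_gt0.
have : geometric (1 - theta S)^-1 (theta S) n @[n --> \oo] --> (0 : R).
  by apply: cvg_geometric; rewrite ger0_norm // ltW.
move=> /cvgrPdist_lt /(_ e e0) [n _ /(_ n (leqnn n))] /=.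
rewrite sub0r normrN ger0_norm; last first.
  by rewrite mulr_ge0 ?invr_ge0 ?exprn_ge0 // ltW.
move=> ne; exists n => y /cylP xy; apply: le_lt_trans ne.
by rewrite mulrC; apply: mdist_agree => i /xy.
Qed.

Definition cylinders : set (set (borel X)) := [set A | A = set0 \/ exists s, A = cyl s].

(** Two cylinders are nested or disjoint. *)
Lemma setI_closed_cylinders : setI_closed cylinders.
Proof.
have key s t : (size s <= size t)%N ->
    cyl s `&` cyl t = set0 \/ cyl s `&` cyl t = cyl t.
  move=> st; case: (pselect (exists x, (cyl s `&` cyl t) x)) => [[x [xs xt]]|n].
    right; rewrite -xs -xt; apply/seteqP; split => y; first by case.
    move=> yt; split => //; move/cylP : yt => yx; apply/cylP => i si.
    by apply: yx; rewrite (leq_trans si).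
  by left; apply/seteqP; split => // x xst; exfalso; apply: n; exists x.
move=> A B [->|[s ->]]; first by left; rewrite set0I.
move=> [->|[t ->]]; first by left; rewrite setI0.
case/orP: (leq_total (size s) (size t)) => /key.
  by move=> [->|->]; [left|right; exists t].
by rewrite setIC => -[->|->]; [left|right; exists s].
Qed.

(** Every open set is the union of the countably many cylinders it contains. *)
Lemma measurable_cylinders :
  @measurable _ (borel X) = <<s cylinders >>.
Proof.
apply/seteqP; split.
  apply: smallest_sub; first exact: smallest_sigma_algebra.
  move=> U /open_mdist oU.
  have -> : U = \bigcup_(s : seq 'I_(nsym S)) (if pselect (cyl s `<=` U) then cyl s else set0).
    apply/seteqP; split => [x Ux|x [s _]]; last by case: pselect => [sU /sU|_ []].
    have [e e0 eU] := oU x Ux; have [n xn] := cyl_small x e0.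
    exists (mkseq x n) => //; case: pselect => [xU|nU]; first exact/cylP.
    by exfalso; apply: nU => y /xn/eU.
  apply: (@countable_bigcupT_measurable _ (g_sigma_algebraType cylinders)) => // s.
  apply: sub_sigma_algebra; case: pselect => [sU|nU]; last by left.
  by right; exists s.
apply: smallest_sub; first exact: sigma_algebra_measurable.
by move=> A [->|[s ->]]; [exact: measurable0|exact: measurable_cyl].
Qed.

(** Cylinders form a generating pi-system. *)
Lemma measure_cyl_unique (m1 m2 : {measure set (borel X) -> \bar R}) :
  (m1 setT < +oo)%E -> (forall s, m1 (cyl s) = m2 (cyl s)) ->
  forall A, measurable A -> m1 A = m2 A.
Proof.
move=> m1oo m12; apply: (@measure_unique _ _ _ cylinders (fun=> setT)) => //.
- exact: measurable_cylinders.
- exact: setI_closed_cylinders.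
- by move=> _; right; exists [::]; rewrite cyl_nil.
- by rewrite bigcup_const.
- by move=> A [->|[s ->]]; rewrite ?measure0.
Qed.

Lemma measurable_shift :
  measurable_fun [set: borel X] (@shift R S : borel X -> borel X).
Proof.
apply: measurable_fun_borel => U /open_mdist oU; apply/open_mdist => x Ux.
have [e e0 eU] := oU _ Ux; exists (theta S * e); first by rewrite mulr_gt0 ?theta_gt0.
move=> y xy; apply: eU; rewrite -(ltr_pM2l (theta_gt0 S)).
exact: le_lt_trans (mdist_shift_le _ _) _.
Qed.

End cylinders.

(** * Markov measures *)

Lemma ae_mono {R : realType} d (T : measurableType d) (mu : {measure set T -> \bar R})
  (P Q : T -> Prop) : (forall x, P x -> Q x) ->
  {ae mu, forall x, P x} -> {ae mu, forall x, Q x}.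
Proof. by move=> PQ; apply: filterS. Qed.

Lemma ae_mono2 {R : realType} d (T : measurableType d) (mu : {measure set T -> \bar R})
  (P Q W : T -> Prop) : (forall x, P x -> Q x -> W x) ->
  {ae mu, forall x, P x} -> {ae mu, forall x, Q x} -> {ae mu, forall x, W x}.
Proof. by move=> PQW; apply: filterS2. Qed.

Section mixture.
Local Open Scope ereal_scope.
Context {R : realType} d d' (X : measurableType d) (Y : measurableType d').

Lemma giry_bindE (m : probability X R) (k : X -> giry Y R)
    (mk : measurable_fun [set: X] k) A : measurable A ->
  giry_bind m mk A = \int[m]_x (k x : subprobability Y R) A.
Proof.
move=> mA; have mI : measurable_fun [set: Y] (EFin \o \1_A : Y -> \bar R).
  exact/measurable_EFinP/measurable_indic.
have I0 y : 0 <= (EFin \o \1_A : Y -> \bar R) y by rewrite lee_fin.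
have := giry_int_bind m mk mI I0; rewrite /giry_int /= integral_indic // setIT => bE.
by rewrite [LHS]bE; apply: eq_integral => x _; rewrite /= integral_indic // setIT.
Qed.

Lemma integral_mixture (m : probability X R) (k : X -> subprobability Y R)
    (mu : {measure set Y -> \bar R}) (f : Y -> \bar R) :
  (forall E, measurable E -> measurable_fun [set: X] (fun x => k x E)) ->
  (forall E, measurable E -> mu E = \int[m]_x k x E) ->
  measurable_fun [set: Y] f -> (forall y, 0 <= f y) ->
  \int[mu]_y f y = \int[m]_x \int[k x]_y f y.
Proof.
move=> mk muE mf f0.
have mk' : measurable_fun [set: X] (k : X -> giry Y R).
  exact: measurable_giry_codensity.
rewrite -[RHS](giry_int_bind m mk' mf f0); apply: eq_measure_integral => A mA _.
by rewrite [RHS](giry_bindE m mk') // muE.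
Qed.

End mixture.

Section markov_theory.
Context {R : realType} (S : subshift R) (p : 'M[R]_(nsym S)) (q : 'rV[R]_(nsym S)).
Local Notation X := (shift_space S).

Section stochastic.
Hypothesis st : stochastic_data p q.

Lemma p_ge0 i j : 0 <= p i j. Proof. by case: st => -[]. Qed.

Lemma p_gt0 i j : trans S i j = 1%N -> 0 < p i j.
Proof. by case: st => _ pt _ _ /pt. Qed.

Lemma p_eq0 i j : trans S i j <> 1%N -> p i j = 0.
Proof.
move=> tn; apply/eqP; rewrite eq_le p_ge0 andbT leNgt; apply/negP.
by case: st => _ pt _ _ /pt.
Qed.

(** A zero of a nonnegative stationary vector spreads to all predecessors,
    hence everywhere by aperiodicity. *)
Lemma stationary_zero (v : 'rV[R]_(nsym S)) j :
  (forall i, 0 <= v 0 i) -> v *m p = v -> v 0 j = 0 -> forall i, v 0 i = 0.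
Proof.
move=> v0 vp vj i; have [n _ /(_ i j)] := trans_aperiodic S.
elim: n i => [|n IH] i.
  by rewrite expr0 mxE; case: eqVneq => // ->.
rewrite exprS mxE => s0.
have [k] : exists k, (0 < trans S i k * (trans S ^+ n) k j)%N.
  apply: contrapT => /forallNP nk; move: s0; rewrite big1 // => k _.
  by apply/eqP; rewrite -leqn0 leqNgt; apply/negP; exact: nk.
rewrite muln_gt0 => /andP[ik /IH vk].
have pik : 0 < p i k.
  by apply: p_gt0; case: (trans01 i k) ik => ->.
have vpk : \sum_l v 0 l * p l k = 0.
  by have := congr1 (fun w : 'rV_(nsym S) => w 0 k) vp; rewrite mxE vk.
have := @psumr_eq0P _ _ xpredT _ (fun l _ => mulr_ge0 (v0 l) (p_ge0 l k)) vpk i (erefl true).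
by move=> /eqP; rewrite mulf_eq0 (gt_eqF pik) orbF => /eqP.
Qed.

Lemma q_gt0 i : 0 < q 0 i.
Proof.
case: st => _ _ [q0 q1] qp; rewrite lt_neqAle q0 andbT eq_sym.
apply/eqP => qi; have qz := stationary_zero q0 qp qi.
by move: q1; rewrite big1 // => /eqP; rewrite eq_sym oner_eq0.
Qed.

(** The stationary vector spans the left eigenspace of eigenvalue 1: subtract
    the largest multiple of [q] that leaves the difference nonnegative. *)
Lemma stationary_unique (f : 'I_(nsym S) -> R) :
  (forall j, \sum_i f i * q 0 i * p i j = f j * q 0 j) -> forall i j, f i = f j.
Proof.
move=> fq.
have [k _ fk] := @arg_minP _ _ _ (Ordinal (nsym_gt0 S)) xpredT f isT.
suff H i : f i = f k by move=> i j; rewrite !H.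
pose v : 'rV[R]_(nsym S) := \row_i ((f i - f k) * q 0 i).
have v0 i' : 0 <= v 0 i' by rewrite mxE mulr_ge0 ?subr_ge0 ?fk // ltW // q_gt0.
have vp : v *m p = v.
  apply/rowP => j; rewrite !mxE.
  transitivity (\sum_i f i * q 0 i * p i j - f k * \sum_i q 0 i * p i j).
    rewrite mulr_sumr -sumrB; apply: eq_bigr => i' _; rewrite mxE; ring.
  have [_ _ _ qp] := st; have := congr1 (fun w : 'rV_(nsym S) => w 0 j) qp.
  by rewrite fq mxE => ->; ring.
have vk : v 0 k = 0 by rewrite mxE subrr mul0r.
have /eqP := stationary_zero v0 vp vk i; rewrite mxE.
by rewrite mulf_eq0 (gt_eqF (q_gt0 i)) orbF subr_eq0 => /eqP.
Qed.

End stochastic.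

Variable m : probability (borel X) R.
Hypothesis hm : markov_measure p q m.
Let st : stochastic_data p q := hm.1.

Fixpoint path_weight i (s : seq 'I_(nsym S)) : R :=
  if s is j :: s' then p i j * path_weight j s' else 1.

Lemma markov_cyl i s : m (cyl (i :: s)) = (q 0 i * path_weight i s)%:E.
Proof.
have -> : cyl (i :: s) =
    [set x : X | forall k, (k <= size s)%N -> x k = nth i (i :: s) k].
  apply/seteqP; split => x /= xs.
    by move=> k ks; rewrite -[in RHS]xs (nth_mkseq i x).
  apply: (@eq_from_nth _ i); rewrite size_mkseq // => k ks.
  by rewrite (nth_mkseq i x) // xs.
rewrite hm.2; congr (_ * _)%:E.
have : forall d, \prod_(k < size s) p (nth d (i :: s) k) (nth d (i :: s) k.+1) = path_weight i s.
  move=> d; elim: s i => [|j s IH] i /=; first by rewrite big_ord0.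
  by rewrite big_ord_recl /= -IH.
exact.
Qed.

Lemma markov_cyl_gt0 (x : X) n : (0 < m (cyl (mkseq x n)))%E.
Proof.
case: n => [|n]; first by rewrite /mkseq /= cyl_nil probability_setT.
have -> : mkseq x n.+1 = x 0%N :: mkseq (shift x) n.
  by rewrite /mkseq /= -[1%N]addn0 iotaDl -map_comp.
rewrite markov_cyl lte_fin mulr_gt0 ?q_gt0 //.
elim: n x => [|n IH] x; first exact: ltr01.
have -> : mkseq (shift x) n.+1 = shift x 0%N :: mkseq (shift (shift x)) n.
  by rewrite /mkseq /= -[1%N]addn0 iotaDl -map_comp.
by apply: mulr_gt0; [apply: (p_gt0 st); exact: coordP|exact: IH].
Qed.

(** The Markov measure charges every cylinder, so a set of full measure meets
    every ball. *)
Lemma ae_dense (P : X -> Prop) : {ae m, forall x, P x} ->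
  forall x e, 0 < e -> exists2 y, P y & mdist x y < e.
Proof.
move=> [N [mN N0 PN]] x e e0; have [n xn] := cyl_small x e0.
apply: contrapT => nP.
have cN : cyl (mkseq x n) `<=` N.
  by move=> y yc; apply: PN => Py; apply: nP; exists y => //; exact: xn.
have := markov_cyl_gt0 x n; rewrite ltNge => /negP; apply.
by rewrite -N0 le_measure ?inE //; exact: measurable_cyl.
Qed.

(** Lipschitz on each one-cylinder only: the averages over the past taken below
    have weights that jump when the initial symbol changes. *)
Definition loclip (c : R) (u : X -> R) :=
  forall x y : X, x 0%N = y 0%N -> `|u x - u y| <= c * mdist x y.

Lemma measurable_loclip c u : 0 <= c -> loclip c u ->
  measurable_fun [set: borel X] (u : borel X -> R).
Proof.
move=> c0 uc; apply: (@measurable_fun_real R (shift_space S) u) => x e e0.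
have c1 : 0 < c + 1 by rewrite ltr_wpDl.
exists (Num.min 1 (e / (c + 1))); first by rewrite lt_min ltr01 divr_gt0.
move=> y; rewrite lt_min => /andP[xy1 xye].
have xy := mdist_lt1 xy1.
apply: (le_lt_trans (uc _ _ xy)); move: xye; rewrite ltr_pdivlMr // mulrC.
by apply: le_lt_trans; rewrite ler_wpM2r ?mdist_ge0 // lerDl.
Qed.

Lemma measurable_branch i :
  measurable_fun [set: borel X] (@branch R S i : borel X -> borel X).
Proof.
apply: measurable_fun_borel => U /open_mdist oU; apply/open_mdist => x Ux.
have [e e0 eU] := oU _ Ux; exists (Num.min 1 e); first by rewrite lt_min ltr01.
move=> y; rewrite lt_min => /andP[xy1 xye].
have xy := mdist_lt1 xy1.
apply: eU; case: (pselect (trans S i (x 0%N) = 1%N)) => h.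
  rewrite mdist_branch //; apply: le_lt_trans xye.
  by rewrite ler_piMl ?mdist_ge0 // ltW // theta_lt1.
rewrite /branch; case: pselect => // _; case: pselect => // h'.
by exfalso; apply: h; rewrite xy.
Qed.

(** The conditional probability of the symbol [i] at time -1, given a path [x]
    from time 0 on. *)
Definition back_weight i (x : X) : R := q 0 i * p i (x 0%N) / q 0 (x 0%N).

Lemma back_weight_ge0 i x : 0 <= back_weight i x.
Proof. by rewrite divr_ge0 ?mulr_ge0 ?p_ge0 // ltW // q_gt0. Qed.

Lemma back_weight_sum x : \sum_i back_weight i x = 1.
Proof.
have [_ _ _ qp] := st; have := congr1 (fun v : 'rV_(nsym S) => v 0 (x 0%N)) qp.
by rewrite -mulr_suml mxE => ->; rewrite divff // gt_eqF // q_gt0.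
Qed.

Lemma back_weight_eq0 i (x : X) : trans S i (x 0%N) <> 1%N -> back_weight i x = 0.
Proof. by move=> h; rewrite /back_weight (p_eq0 st h) mulr0 mul0r. Qed.

Lemma back_weight_eq i (x y : X) : x 0%N = y 0%N -> back_weight i x = back_weight i y.
Proof. by rewrite /back_weight => ->. Qed.

Lemma measurable_back_weight i :
  measurable_fun [set: borel X] (back_weight i : borel X -> R).
Proof.
apply: (@measurable_loclip 0) => // x y xy.
by rewrite (back_weight_eq _ xy) subrr normr0 mul0r.
Qed.

End markov_theory.

(** * The transfer operator *)

Section transfer_operator.
Context {R : realType} (S : subshift R) (p : 'M[R]_(nsym S)) (q : 'rV[R]_(nsym S)).
Local Notation X := (shift_space S).
Variable m : probability (borel X) R.
Hypothesis hm : markov_measure p q m.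
Local Notation w := (back_weight p q).

(* Finite sums of measures are indexed by natural numbers; the default value is
   never reached. *)
Let sym (n : nat) : 'I_(nsym S) := insubd (Ordinal (nsym_gt0 S)) n.

Let symK (i : 'I_(nsym S)) : sym i = i. Proof. exact: valKd. Qed.

(** The conditional law, given the path from time 0 on, of the path from
    time -1 on. *)
Definition back_kernel (x : X) : set (borel X) -> \bar R :=
  msum (fun n => mscale (NngNum (back_weight_ge0 hm (sym n) x))
                        (dirac (branch (sym n) x : borel X))) (nsym S).

HB.instance Definition _ x := Measure.on (back_kernel x).

Let back_kernelE x E :
  back_kernel x E = (\sum_i w i x * \1_E (branch i x))%:E.
Proof.
rewrite /back_kernel /msum /= -sumEFin; apply: eq_bigr => i _.
by rewrite /mscale /= symK diracE indicE.
Qed.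

Let back_kernel_setT x : (back_kernel x setT <= 1)%E.
Proof.
rewrite back_kernelE lee_fin -(back_weight_sum hm x) ler_sum // => i _.
by rewrite indicE in_setT mulr1.
Qed.

HB.instance Definition _ x :=
  Measure_isSubProbability.Build _ _ _ (back_kernel x) (back_kernel_setT x).

Let measurable_back_kernel E : measurable E ->
  measurable_fun [set: borel X] (fun x => back_kernel x E).
Proof.
move=> mE; rewrite (funext (fun x => back_kernelE x E)).
apply/measurable_EFinP; apply: measurable_sum => i.
apply: measurable_funM; first exact: measurable_back_weight.
apply: (@measurableT_comp _ _ _ (borel X) (borel X) _ (\1_E : borel X -> R)) => //.
exact: measurable_branch.
Qed.

Let kernel_nil x : back_kernel x (cyl [::]) = 1%E.
Proof.
rewrite back_kernelE -(back_weight_sum hm x); congr _%:E; apply: eq_bigr => i _.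
by rewrite cyl_nil indicE in_setT mulr1.
Qed.

Let kernel_cons x i s : back_kernel x (cyl (i :: s)) = (w i x * \1_(cyl s) x)%:E.
Proof.
rewrite back_kernelE (bigD1 i) //= big1 ?addr0 => [|j ji].
  case: (pselect (trans S i (x 0%N) = 1%N)) => [h|/(back_weight_eq0 hm) ->].
    congr (_ * _)%:E; rewrite !indicE; congr (nat_of_bool _)%:R.
    rewrite cyl_cons; apply/idP/idP; rewrite !inE /= branchK // ?branch0 //.
    by move=> [].
  by rewrite !mul0r.
case: (pselect (trans S j (x 0%N) = 1%N)) => [h|/(back_weight_eq0 hm) ->].
  rewrite indicE memNset ?mulr0 // cyl_cons /= branch0 // => -[jj _].
  by rewrite jj eqxx in ji.
by rewrite mul0r.
Qed.

(** Stationarity, read backwards: prepending a random symbol preserves [m]. *)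
Lemma back_kernel_invariant E : measurable E ->
  m E = (\int[m]_x back_kernel x E)%E.
Proof.
move=> mE.
pose k : borel X -> subprobability (borel X) R := fun x => back_kernel x.
have mk : measurable_fun [set: borel X] (k : borel X -> giry (borel X) R).
  exact: measurable_giry_codensity.
have bE A : measurable A -> giry_bind m mk A = (\int[m]_x back_kernel x A)%E.
  exact: giry_bindE.
rewrite -bE //; apply: (@measure_cyl_unique _ _ m (giry_bind m mk) _ _ E mE).
  exact: le_lt_trans (probability_le1 m measurableT) (ltry _).
move=> s; rewrite [RHS]bE; last exact: measurable_cyl.
case: s => [|i s].
  under eq_integral do rewrite kernel_nil.
  by rewrite cyl_nil integral_cst // mul1e.
under eq_integral do rewrite kernel_cons.
(* The weight only depends on the symbol at time 0, hence is constant on a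
   nonempty cylinder. *)
have const j t : (\int[m]_x (w i x * \1_(cyl (j :: t)) x)%:E =
    (q 0 i * p i j / q 0 j)%:E * m (cyl (j :: t)))%E.
  have mc := measurable_cyl (j :: t).
  have -> : m (cyl (j :: t)) = (\int[m]_x (\1_(cyl (j :: t)) x)%:E)%E.
    by rewrite integral_indic // setIT.
  rewrite -ge0_integralZl //.
  - apply: eq_integral => x _; rewrite -EFinM indicE; congr _%:E.
    by have [|] := boolP (x \in _); rewrite ?mulr0 // inE cyl_cons => -[<-].
  - by apply/measurable_EFinP; apply: measurable_indic.
  - by rewrite lee_fin divr_ge0 ?mulr_ge0 ?(p_ge0 hm.1) // ltW // (q_gt0 hm.1).
have qN j : q 0 j != 0 by rewrite gt_eqF // (q_gt0 hm.1).
case: s => [|j s]; last first.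
  rewrite [RHS]const [LHS](markov_cyl hm) (markov_cyl hm) -EFinM; congr EFin => /=.
  by field.
rewrite [LHS](markov_cyl hm) /= mulr1.
transitivity (\int[m]_x (\sum_j (w i x * \1_(cyl [:: j]) x)%:E))%E; last first.
  apply: eq_integral => x _; rewrite sumEFin -mulr_sumr; congr (_ * _)%:E.
  rewrite (bigD1 (x 0%N)) //= big1 ?addr0 => [|j jx].
    by rewrite !indicE cyl_nil in_setT mem_set // cyl1.
  by rewrite indicE memNset // cyl1 /= => xj; rewrite xj eqxx in jx.
rewrite ge0_integral_sum //; first last.
- by move=> j x _; rewrite lee_fin mulr_ge0 ?(back_weight_ge0 hm).
- move=> j; apply/measurable_EFinP; apply: measurable_funM.
    exact: measurable_back_weight.
  by apply: measurable_indic; exact: measurable_cyl.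
under eq_bigr do rewrite const (markov_cyl hm) -EFinM.
rewrite sumEFin; congr _%:E; have [[_ p1] _ _ _] := hm.1.
rewrite -[LHS]mulr1 -(p1 i) mulr_sumr; apply: eq_bigr => j _ /=.
by rewrite mulr1 divfK.
Qed.

Lemma integral_back (g : borel X -> \bar R) :
  measurable_fun [set: borel X] g -> (forall x, 0 <= g x)%E ->
  (\int[m]_x g x = \int[m]_x \sum_i (w i x)%:E * g (branch i x))%E.
Proof.
move=> mg g0.
rewrite (@integral_mixture _ _ _ _ _ m (fun x => back_kernel x : subprobability (borel X) R) m g) //; last first.
  exact: back_kernel_invariant.
apply: eq_integral => x _.
rewrite [LHS]ge0_integral_measure_sum //; apply: eq_bigr => i _.
rewrite ge0_integral_mscale //= integral_dirac //= symK.
by rewrite diracT mul1e.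
Qed.

Definition transfer (u : X -> R) (x : X) : R := \sum_i w i x * u (branch i x).

(** Prepending a common symbol multiplies the distance by [theta], and the
    weights depend on the initial symbol only: this is what gives the
    contraction. *)
Lemma loclip_transfer c u : loclip c u -> loclip (c * theta S) (transfer u).
Proof.
move=> uc x y xy; rewrite /transfer -sumrB.
apply: (le_trans (ler_norm_sum _ _ _)).
rewrite -[leRHS]mul1r -(back_weight_sum hm x) mulr_suml; apply: ler_sum => i _.
rewrite -(back_weight_eq p q i xy) -mulrBr normrM ger0_norm ?(back_weight_ge0 hm) //.
case: (pselect (trans S i (x 0%N) = 1%N)) => [h|/(back_weight_eq0 hm) ->].
  rewrite ler_wpM2l ?(back_weight_ge0 hm) // -mulrA -(mdist_branch h xy).
  by apply: uc; rewrite !branch0 // -xy.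
by rewrite !mul0r.
Qed.

Lemma transfer_ge0 u : (forall x, 0 <= u x) -> forall x, 0 <= transfer u x.
Proof. by move=> u0 x; rewrite sumr_ge0 // => i _; rewrite mulr_ge0 ?(back_weight_ge0 hm). Qed.

Lemma transferD_cst u c x : transfer (fun x => u x + c) x = transfer u x + c.
Proof.
rewrite /transfer -[X in _ + X]mul1r -(back_weight_sum hm x) mulr_suml -big_split /=.
by apply: eq_bigr => i _; rewrite mulrDr.
Qed.

(** The transfer operator is dual to composition with the shift: average over
    the past in the integral, on which the shift forgets the added symbol. *)
Lemma integral_transfer c (u : X -> R) (E : set (borel X)) : 0 <= c -> loclip c u -> (forall x, 0 <= u x) ->
  measurable E ->
  (\int[m]_(x in @shift R S @^-1` E) (u x)%:E = \int[m]_(x in E) (transfer u x)%:E)%E.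
Proof.
move=> c0 uc u0 mE.
have mu : measurable_fun [set: borel X] (u : borel X -> R) by exact: measurable_loclip uc.
have msE : measurable (@shift R S @^-1` E : set (borel X)).
  by rewrite -[_ @^-1` _]setTI; exact: measurable_shift.
rewrite integral_mkcond integral_back; first last.
- by move=> x; rewrite patchE; case: ifP => //; rewrite lee_fin.
- by apply/(measurable_restrictT _ _).1 => //; apply: measurable_funTS; exact/measurable_EFinP.
rewrite [RHS]integral_mkcond; apply: eq_integral => x _; rewrite patchE.
case: ifPn => xE.
  rewrite -sumEFin; apply: eq_bigr => i _.
  case: (pselect (trans S i (x 0%N) = 1%N)) => [h|/(back_weight_eq0 hm) ->].
    by rewrite patchE mem_set //= branchK //; exact: set_mem.
  by rewrite mul0e mul0r.
rewrite big1 // => i _.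
case: (pselect (trans S i (x 0%N) = 1%N)) => [h|/(back_weight_eq0 hm) ->].
  rewrite patchE memNset ?mule0 //= branchK // => Ex.
  by rewrite mem_set in xE.
by rewrite mul0e.
Qed.

Lemma loclip_iter_transfer c u n :
  loclip c u -> loclip (c * theta S ^+ n) (iter n transfer u).
Proof.
move=> uc; elim: n => [|n IH]; first by rewrite expr0 mulr1.
by rewrite exprSr mulrA; exact: loclip_transfer.
Qed.

Lemma iter_transfer_ge0 u n : (forall x, 0 <= u x) ->
  forall x, 0 <= iter n transfer u x.
Proof. by move=> u0; elim: n => // n IH; exact: transfer_ge0. Qed.

Lemma iter_transferD_cst u c n x :
  iter n transfer (fun x => u x + c) x = iter n transfer u x + c.
Proof.
elim: n x => //= n IH x; rewrite -transferD_cst; congr transfer.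
by apply/funext.
Qed.

Lemma integral_iter_transfer c (u : X -> R) n (E : set (borel X)) : 0 <= c -> loclip c u -> (forall x, 0 <= u x) ->
  measurable E ->
  (\int[m]_(x in iter n (@shift R S) @^-1` E) (u x)%:E =
   \int[m]_(x in E) (iter n transfer u x)%:E)%E.
Proof.
move=> c0 uc u0; elim: n E => [//|n IH] E mE.
rewrite /= -[RHS](integral_transfer _ (loclip_iter_transfer n uc)) //; last 2 first.
- by rewrite mulr_ge0 ?exprn_ge0 // ltW // theta_gt0.
- exact: iter_transfer_ge0.
rewrite -IH; last by rewrite -[_ @^-1` _]setTI; exact: measurable_shift.
by [].
Qed.

End transfer_operator.

(** * Invariant Lipschitz densities *)

Lemma le_of_geometric {R : realType} (a c b r : R) : 0 <= r -> r < 1 ->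
  (forall n : nat, a <= c + b * r ^+ n) -> a <= c.
Proof.
move=> r0 r1 h.
have nr : `|r| < 1 by rewrite ger0_norm.
have cv : c + geometric b r n @[n --> \oo] --> c + 0.
  by apply: cvgD; [exact: cvg_cst|exact: cvg_geometric].
rewrite -[c]addr0 -(cvg_lim _ cv) //; apply: limr_ge; first by apply/cvg_ex; exists (c + 0).
by apply: nearW => n; exact: h.
Qed.

Section invariant_density.
Context {R : realType} (S : subshift R) (p : 'M[R]_(nsym S)) (q : 'rV[R]_(nsym S)).
Local Notation X := (shift_space S).
Variable m : probability (borel X) R.
Hypothesis hm : markov_measure p q m.
Local Notation P := (transfer p q).

(** Both sides are continuous and a set of full measure is dense. *)
Lemma ae_eq_loclip c (u v : X -> R) : 0 <= c -> loclip c u -> loclip c v ->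
  {ae m, forall x, u x = v x} -> forall x, u x = v x.
Proof.
move=> c0 uc vc uv x; apply/eqP; rewrite -subr_eq0 -normr_le0; apply/ler_addgt0Pr => e e0.
have c1 : 0 < 2 * c + 1 by rewrite ltr_wpDl // mulr_ge0.
have [y uvy] := ae_dense hm uv x (e := Num.min 1 (e / (2 * c + 1)))
  ltac:(by rewrite lt_min ltr01 divr_gt0).
rewrite lt_min ltr_pdivlMr // => /andP[/mdist_lt1 xy dxy].
have -> : u x - v x = (u x - u y) - (v x - v y) by rewrite uvy; ring.
rewrite add0r (le_trans (ler_normB _ _)) //.
have := uc _ _ xy; have := vc _ _ xy; have := mdist_ge0 x y; nra.
Qed.

Lemma exists_start i : exists x : X, x 0%N = i.
Proof.
apply: contrapT => nx; have := markov_cyl hm i [::].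
have -> : cyl [:: i] = set0.
  by rewrite cyl1; apply/seteqP; split => // x xi; apply: nx; exists x.
rewrite measure0 /= mulr1 => -[q0].
by have := q_gt0 hm.1 i; rewrite -q0 ltxx.
Qed.

(** An invariant Lipschitz density is fixed by the transfer operator, whose
    iterates contract the Lipschitz constant on each one-cylinder to 0. It is
    thus a function of the initial symbol, which yields a stationary vector. *)
Lemma invariant_density_eq1 (phi : X -> R) : Ftheta phi ->
  {ae m, forall x, 0 <= phi x} ->
  (\int[m]_x (phi x)%:E = 1)%E ->
  (forall E : set (borel X), measurable E ->
    \int[m]_(x in @shift R S @^-1` E) (phi x)%:E = \int[m]_(x in E) (phi x)%:E)%E ->
  forall x, phi x = 1.
Proof.
move=> [L phiL] ae0 int1 inv.
pose c := `|L|; have c0 : 0 <= c := normr_ge0 L.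
have t0 := ltW (theta_gt0 S); have t1 := theta_lt1 S.
have pc : loclip c phi.
  move=> x y _; apply: (le_trans (phiL x y)).
  by rewrite ler_wpM2r ?mdist_ge0 // ler_norm.
have mphi : measurable_fun [set: borel X] (phi : borel X -> R).
  exact: measurable_loclip pc.
(* [phi] agrees almost everywhere with its positive part, which is Lipschitz. *)
have phi0 x : 0 <= phi x.
  have : loclip c (fun x => Num.max 0 (phi x)).
    move=> x1 x2 xx; apply: le_trans (pc _ _ xx); rewrite !maxEle.
    by case: (lerP 0 (phi x1)) => h1; case: (lerP 0 (phi x2)) => h2; rewrite ler_norml; have := ler_norm (phi x1 - phi x2);
      have := ler_norm (- (phi x1 - phi x2)); rewrite normrN; lra.
  move=> /(ae_eq_loclip c0 pc) phiE.
  have -> : phi x = Num.max 0 (phi x); last by rewrite le_max lexx.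
  by apply: phiE; apply: ae_mono ae0 => y y0; rewrite max_r.
have Pc : loclip c (P phi).
  move=> x y xy; apply: le_trans (loclip_transfer hm pc xy) _.
  by rewrite ler_wpM2r ?mdist_ge0 // ler_piMr // ltW.
have mP : measurable_fun [set: borel X] (P phi : borel X -> R).
  exact: measurable_loclip Pc.
have Pphi x : P phi x = phi x.
  apply/esym; move: x; apply: (ae_eq_loclip c0 pc Pc).
  have : ae_eq m setT (fun x => (phi x)%:E) (fun x => (P phi x)%:E).
    apply: integral_ae_eq => //.
    - apply/integrableP; split; first exact/measurable_EFinP.
      under eq_integral do rewrite gee0_abs ?lee_fin //.
      by rewrite int1 ltry.
    - exact/measurable_EFinP.
    - by move=> E _ mE; rewrite -inv // (integral_transfer hm c0 pc).
  by apply: ae_mono => x /(_ I) [].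
have iterP n : iter n P phi = phi.
  by elim: n => //= n ->; apply/funext.
have const (x y : X) : x 0%N = y 0%N -> phi x = phi y.
  move=> xy; apply/eqP; rewrite -subr_eq0 -normr_le0.
  apply: (@le_of_geometric _ _ _ (c * mdist x y) (theta S)) => // n.
  rewrite add0r mulrAC -{1 2}(iterP n); exact: (loclip_iter_transfer hm).
pose pt i := sval (cid (exists_start i)).
have pt0 i : pt i 0%N = i := svalP (cid (exists_start i)).
have pf x : phi x = phi (pt (x 0%N)) by apply: const; rewrite pt0.
have fcst i j : phi (pt i) = phi (pt j).
  apply: (stationary_unique hm.1 (f := phi \o pt)) => {i}j /=; have qj := q_gt0 hm.1 j.
  rewrite -[in RHS]Pphi /transfer mulr_suml; apply: eq_bigr => i _.
  rewrite /back_weight pt0.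
  case: (pselect (trans S i j = 1%N)) => [h|/(p_eq0 hm.1) ->].
    by rewrite (pf (branch i _)) branch0 ?pt0 //; field; rewrite gt_eqF.
  by rewrite !mulr0 !mul0r.
move=> x; move: int1.
rewrite (eq_integral (cst (phi x)%:E)) => [|y _]; last first.
  by rewrite /= pf (pf x); congr _%:E; exact: fcst.
by rewrite integral_cst // [X in (_ * X)%E](probability_setT m) mule1 => -[].
Qed.

End invariant_density.

(** * Iterates of the skew product *)

Section ae_comparison.
Local Open Scope ereal_scope.
Context d (T : measurableType d) {R : realType}.

(** On the set where [g < f] the two indefinite integrals coincide, so that
    [f = g] almost everywhere there: the set is null. *)
Lemma ae_le_of_integral_le (mu : {measure set T -> \bar R}) (f g : T -> \bar R) :
  measurable_fun setT f -> measurable_fun setT g ->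
  (forall x, 0 <= f x) -> (forall x, 0 <= g x) -> \int[mu]_x g x < +oo ->
  (forall E, measurable E -> \int[mu]_(x in E) f x <= \int[mu]_(x in E) g x) ->
  {ae mu, forall x, f x <= g x}.
Proof.
move=> mf mg f0 g0 goo fg.
have mD : measurable [set x | g x < f x].
  by rewrite -[X in measurable X]setTI; exact: emeasurable_fun_lt.
have : ae_eq mu [set x | g x < f x] g f.
  apply: integral_ae_eq => //.
  - apply: (@integrableS _ _ _ mu setT) => //; apply/integrableP; split => //.
    by under eq_integral do rewrite gee0_abs //.
  - exact: measurable_funTS.
  - move=> E ED mE; apply/eqP; rewrite eq_le fg // andbT; apply: ge0_le_integral => //.
    + exact: measurable_funTS.
    + exact: measurable_funTS.
    + by move=> x /ED /ltW.
by apply: ae_mono => x h; rewrite leNgt; apply/negP => /[dup] /h ->; rewrite ltxx.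
Qed.

End ae_comparison.

Section skew_product_dynamics.
Context {R : realType} (S : subshift R) (K : pmetricType R).
Local Notation X := (shift_space S).
Variables (G : skew_space S K -> borel K) (alpha H : R).
Local Notation F := (skew G).

Lemma iter_skew1 n z : (iter n F z).1 = iter n (@shift R S) z.1.
Proof. by elim: n => //= n ->. Qed.

Lemma measurable_iter_skew n : measurable_fun setT G -> measurable_fun setT (iter n F).
Proof.
move=> mG; elim: n => [|n IH]; first exact: measurable_id.
apply: (@measurableT_comp _ _ _ _ _ _ F) => //.
apply/measurable_fun_pairP; split => //=.
by apply: (@measurableT_comp _ _ _ _ _ _ (@shift R S : borel X -> borel X)) => //; exact: measurable_shift.
Qed.

Hypothesis alpha_ge0 : 0 <= alpha.
Hypothesis alpha_le1 : alpha <= 1.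
Hypothesis G_fibre : forall (x : X) (y1 y2 : K),
  mdist (G (x, y1) : K) (G (x, y2)) <= alpha * mdist y1 y2.
Hypothesis G_base : forall (x1 x2 : X) (y : K),
  mdist (G (x1, y) : K) (G (x2, y)) <= H * mdist x1 x2.

Local Notation Y n x y := ((iter n F (x, y)).2 : K).

Lemma iter_skew_fibre n (x : X) (y1 y2 : K) :
  mdist (Y n x y1) (Y n x y2) <= alpha ^+ n * mdist y1 y2.
Proof.
elim: n => [|n IH]; first by rewrite expr0 mul1r.
rewrite exprS -mulrA; apply: (le_trans _ (ler_wpM2l alpha_ge0 IH)).
move: (iter_skew1 n (x, y1)) (iter_skew1 n (x, y2)) => /=.
case: (iter n F (x, y1)) => a1 b1; case: (iter n F (x, y2)) => a2 b2 /= -> ->.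
exact: G_fibre.
Qed.

(** Going [n] steps forward expands the base by at most [theta ^- n], and each
    step adds the error [H] while the fibre contraction prevents errors from
    growing: the total is a geometric sum. *)
Lemma iter_skew_base n (x1 x2 : X) (y : K) : 0 <= H ->
  theta S ^+ n * mdist (Y n x1 y) (Y n x2 y) <= H / (1 - theta S) * mdist x1 x2.
Proof.
move=> H0; have t0 := theta_gt0 S; have t1 := theta_lt1 S.
have shiftn k : theta S ^+ k * mdist (iter k (@shift R S) x1) (iter k (@shift R S) x2)
    <= mdist x1 x2.
  elim: k => [|k IH]; first by rewrite expr0 mul1r.
  apply: le_trans IH; rewrite exprSr -mulrA ler_wpM2l ?exprn_ge0 ?(ltW t0) //.
  exact: mdist_shift_le.
have d0 := mdist_ge0 x1 x2.
have c0 : 0 < 1 - theta S by rewrite subr_gt0.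
elim: n => [|n IH].
  by rewrite expr0 mul1r /= mdistxx mulr_ge0 // divr_ge0 // ltW.
have := shiftn n; move: (iter_skew1 n (x1, y)) (iter_skew1 n (x2, y)) IH => /=.
case: (iter n F (x1, y)) => a1 b1; case: (iter n F (x2, y)) => a2 b2 /= -> ->.
set s1 := iter n _ x1; set s2 := iter n _ x2 => IH sn.
have tn0 : 0 <= theta S ^+ n by rewrite exprn_ge0 // ltW.
have step : mdist (G (s1, b1) : K) (G (s2, b2)) <= H * mdist s1 s2 + mdist (b1 : K) b2.
  apply: (le_trans (metric_triangle _ (G (s2, b1) : K) _)); apply: lerD; first exact: G_base.
  by apply: (le_trans (G_fibre _ _ _)); rewrite ler_piMl ?mdist_ge0.
apply: (@le_trans _ _ (theta S * (H * mdist x1 x2 + H / (1 - theta S) * mdist x1 x2))).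
  rewrite exprS -mulrA ler_wpM2l ?(ltW t0) //.
  apply: (le_trans (ler_wpM2l tn0 step)); rewrite mulrDr; apply: lerD => //.
  by rewrite mulrCA ler_wpM2l.
have -> : theta S * (H * mdist x1 x2 + H / (1 - theta S) * mdist x1 x2) =
    H / (1 - theta S) * mdist x1 x2 - H * (1 - theta S) * mdist x1 x2.
  by field; rewrite gt_eqF.
by rewrite gerBl mulr_ge0 // mulr_ge0 // ltW.
Qed.

End skew_product_dynamics.

(** * Signed measures and test functions *)

Section jordan_integrals.
Local Open Scope ereal_scope.
Context d (T : measurableType d) {R : realType}.

Lemma charge_decomp (nu : {charge set T -> \bar R}) A : measurable A ->
  nu A = charge_pos nu A - charge_neg nu A.
Proof.
move=> mA; have := jordan_decomp (svalP (cid (svalP (cid (Hahn_decomposition nu))))) mA.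
by rewrite /cadd /= cscaleN1.
Qed.

(** The negative part is minus the measure of a set, hence vanishes. *)
Lemma charge_pos_of_measure (mu : {finite_measure set T -> \bar R}) A :
  measurable A -> charge_pos (charge_of_finite_measure mu) A = mu A.
Proof.
move=> mA; have -> : mu A = charge_of_finite_measure mu A by [].
rewrite charge_decomp //; suff -> : charge_neg (charge_of_finite_measure mu) A = 0.
  by rewrite sube0.
apply/eqP; rewrite eq_le measure_ge0 andbT.
rewrite [leLHS](cjordan_negE (svalP (cid (svalP (cid (Hahn_decomposition _))))) A).
by rewrite /crestr0 mem_set // leeNl oppe0; exact: measure_ge0.
Qed.

Lemma eq_fin_numBD (a b c e : \bar R) :
  a \is a fin_num -> b \is a fin_num -> c \is a fin_num -> e \is a fin_num ->
  (c - e = a - b) <-> (c + b = a + e).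
Proof.
move: a b c e => [a| |] [b| |] [c| |] [e| |] // _ _ _ _.
by rewrite -!EFinB -!EFinD; split => h; have {}h := EFin_inj h; congr EFin; lra.
Qed.

Lemma cancel_shift (a b c e t : \bar R) : c + t + b = a + (e + t) ->
  t \is a fin_num -> a \is a fin_num -> b \is a fin_num ->
  c \is a fin_num -> e \is a fin_num -> c + b = a + e.
Proof.
move: a b c e t => [a| |] [b| |] [c| |] [e| |] [t| |] // + _ _ _ _ _.
by rewrite -!EFinD => h; have {}h := EFin_inj h; congr EFin; lra.
Qed.

(** The integral against a difference of two measures of equal mass does not see
    constants, so the test function may be shifted to be nonnegative; then the
    Jordan parts can be traded for the two measures. *)
Lemma charge_integral_sub (nu : {charge set T -> \bar R})
    (n1 n2 : {finite_measure set T -> \bar R}) (g : T -> R) :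
  n1 setT = n2 setT ->
  (forall A, measurable A -> nu A = n1 A - n2 A) ->
  measurable_fun setT g -> (forall y, `|g y| <= 1)%R ->
  charge_integral nu g = \int[n1]_y (g y + 1)%:E - \int[n2]_y (g y + 1)%:E.
Proof.
move=> n12 nuE mg g1.
have g0 y : 0 <= (g y + 1)%:E.
  by rewrite lee_fin -lerBlDr sub0r; have := g1 y; rewrite ler_norml => /andP[].
have mg1 : measurable_fun setT (fun y => (g y + 1)%:E).
  by apply/measurable_EFinP; exact: measurable_funD.
have ig (n : {finite_measure set T -> \bar R}) : n.-integrable setT (EFin \o g).
  apply: measurable_bounded_integrable => //; first exact: fin_num_fun_lty.
  exists 1%R; split; first exact: num_real.
  by move=> M M1 y _; apply: (le_trans (g1 y)); exact: ltW.
have shift_int (n : {finite_measure set T -> \bar R}) :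
    \int[n]_y (g y + 1)%:E = \int[n]_y (g y)%:E + n setT.
  under eq_integral do rewrite EFinD.
  rewrite integralD //.
  - by rewrite integral_cst // mul1e.
- exact: ig.
- exact: finite_measure_integrable_cst.
have fin (n : {finite_measure set T -> \bar R}) : \int[n]_y (g y + 1)%:E \is a fin_num.
  rewrite shift_int fin_numD fin_num_measure // andbT.
  exact: (integrable_fin_num measurableT (ig n)).
have key : \int[charge_pos nu]_y (g y + 1)%:E + \int[n2]_y (g y + 1)%:E =
    \int[n1]_y (g y + 1)%:E + \int[charge_neg nu]_y (g y + 1)%:E.
  rewrite -!ge0_integral_measure_add //; apply: eq_measure_integral => A mA _.
  rewrite [LHS]measure_addE [RHS]measure_addE.
  by apply/eq_fin_numBD; rewrite ?fin_num_measure // -charge_decomp // nuE.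
have tot : charge_pos nu setT = charge_neg nu setT.
  have := nuE setT measurableT; rewrite n12 subee ?fin_num_measure //.
  rewrite charge_decomp // => /eqP.
  by rewrite sube_eq ?fin_num_adde_defl ?fin_num_measure // add0e => /eqP.
have igP := integrable_fin_num measurableT (ig (charge_pos nu)).
have igN := integrable_fin_num measurableT (ig (charge_neg nu)).
rewrite /charge_integral; apply/eq_fin_numBD; rewrite ?fin //.
have nT := fin_num_measure (charge_neg nu) setT measurableT.
move: key nT (fin n1) (fin n2) igP igN.
rewrite (shift_int (charge_pos nu)) (shift_int (charge_neg nu)) tot.
exact: cancel_shift.
Qed.

End jordan_integrals.

Section dense_test_functions.
Context {R : realType} (K : pmetricType R).
Hypothesis cK : compact [set: K].

Lemma finite_net (e : R) : 0 < e -> exists s : seq K, forall y, exists2 z, z \in s & mdist z y < e.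
Proof.
move=> e0; move: cK; rewrite compact_cover => /(_ K setT (fun z => [set y | mdist z y < e])).
case.
- move=> z _; apply/open_mdist => y /= zy; exists (e - mdist z y); first by rewrite subr_gt0.
  by move=> x yx; rewrite (le_lt_trans (metric_triangle _ y _)) // -ltrBrDl.
- by move=> y _; exists y => //=; rewrite mdistxx.
move=> D _ cov; exists (finmap.enum_fset D) => y.
by have [z zD zy] := cov y I; exists z.
Qed.

(** McShane extension of prescribed values at finitely many points, cut off at
    1 and -1. *)
Definition mcshane (s : seq (K * R)) (y : K) : R :=
  Num.max (-1) (foldr (fun zr acc => Num.min (zr.2 + mdist zr.1 y) acc) 1 s).

Lemma mcshane_Wtest s : Wtest (mcshane s).
Proof.
pose f y := foldr (fun zr acc => Num.min (zr.2 + mdist zr.1 y) acc) (1 : R) s.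
have fl y1 y2 : f y1 - f y2 <= mdist y1 y2.
  rewrite /f; elim: s {f} => [|[z r] s IH] /=; first by rewrite subrr mdist_ge0.
  rewrite lerBlDr ge_min; case: (leP (r + mdist z y2)) => _.
    by rewrite addrCA lerD2l (addrC (mdist y1 _)) (metric_sym y1) metric_triangle.
  by rewrite -[X in _ || X]lerBlDr IH orbT.
have f1 y : f y <= 1.
  by rewrite /f; elim: s {f fl} => [//|[z r] s IH] /=; rewrite ge_min IH orbT.
rewrite /mcshane -/f; split => [y1 y2|y]; rewrite -/(f _).
  rewrite -/(f y2); have h12 := fl y1 y2; have := fl y2 y1; rewrite metric_sym => h21.
  have d0 := mdist_ge0 y1 y2.
  by rewrite ler_norml; case: (lerP (-1) (f y1)) => k1; case: (lerP (-1) (f y2)) => k2; apply/andP; split; lra.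
have := f1 y; rewrite ler_norml; case: (lerP (-1) (f y)) => k1 h; apply/andP; split; lra.
Qed.

(** The extension is at least [g] because [g] is 1-Lipschitz, and a point of the
    net close to [y] bounds it from above. *)
Lemma mcshane_approx (g : K -> R) (s : seq (K * R)) (e d : R) (y : K) :
  Wtest g -> 0 <= e -> 0 <= d ->
  (forall zr, zr \in s -> g zr.1 <= zr.2 <= g zr.1 + e) ->
  (exists2 zr, zr \in s & mdist zr.1 y <= d) ->
  `|g y - mcshane s y| <= e + 2 * d.
Proof.
move=> [gl g1] e0 d0 gs [[z r] zs /= zy].
have [gy0 gy1] : -1 <= g y /\ g y <= 1 by have := g1 y; rewrite ler_norml => /andP[].
pose f := foldr (fun zr acc => Num.min (zr.2 + mdist zr.1 y) acc) (1 : R) s.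
have lo : g y <= f.
  rewrite /f; move: gs {zs f}; elim: s => [//|[z' r'] s IH] gs /=.
  rewrite le_min IH ?andbT => [|zr zrs]; last by apply: gs; rewrite in_cons zrs orbT.
  have /= /andP[h _] := gs (z', r') (mem_head _ _).
  have := gl y z'; rewrite metric_sym ler_norml => /andP[_ h']; lra.
have up : f <= r + mdist z y.
  rewrite /f; move: zs {gs f lo}; elim: s => [//|[z' r'] s IH] /=.
  rewrite in_cons => /orP[/eqP[-> ->]|zs]; first by rewrite ge_min lexx.
  by rewrite ge_min IH ?orbT.
have /= /andP[_ h] := gs _ zs.
have := gl z y; rewrite ler_norml => /andP[_ h'].
rewrite /mcshane -/f ler_norml; case: (lerP (-1) f) => k; apply/andP; split; lra.
Qed.

(** By compactness it is enough to interpolate rational values on the finite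
    nets of a sequence. *)
Lemma dense_Wtest : exists h : nat -> K -> R, (forall n, Wtest (h n)) /\
  forall g, Wtest g -> forall e, 0 < e -> exists n, forall y, `|g y - h n y| <= e.
Proof.
have net n := cid (finite_net (ltac:(by []) : 0 < (n.+1%:R^-1 : R))).
pose code (c : option (nat * seq rat)) : K -> R :=
  if c is Some (n, l) then mcshane (zip (sval (net n)) (map ratr l)) else mcshane [::].
exists (fun n => code (unpickle n)); split.
  by move=> n; case: (unpickle n) => [[k l]|]; exact: mcshane_Wtest.
move=> g gW e e0.
have e4 : 0 < e / 4 by rewrite divr_gt0.
pose N := Num.truncn (e / 4)^-1.
have Ne : (N.+1%:R^-1 : R) < e / 4.
  rewrite -[ltRHS]invrK ltf_pV2 ?posrE ?ltr0n ?invr_gt0 //.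
  exact: truncnS_gt.
have rat_near (z : K) : {r : rat | g z <= ratr r <= g z + e / 2}.
  have ge : g z < g z + e / 2 by rewrite ltrDl divr_gt0.
  have [r] := cid (rat_in_itvoo ge).
  by rewrite in_itv /= => /andP[h1 h2]; exists r; rewrite !ltW.
pose l := map (fun z => sval (rat_near z)) (sval (net N)).
exists (pickle (N, l)) => y; rewrite pickleK /=.
have -> : e = e / 2 + 2 * (e / 4) by field.
have zipE : zip (sval (net N)) (map ratr l) =
    map (fun z => (z, ratr (sval (rat_near z)) : R)) (sval (net N)).
  by rewrite /l; elim: (sval (net N)) => //= a s ->.
rewrite zipE; apply: mcshane_approx => //.
- by rewrite ltW // divr_gt0.
- exact: ltW.
- by move=> zr /mapP[z _ ->] /=; exact: (svalP (rat_near z)).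
have [z zs zy] := svalP (net N) y.
exists (z, ratr (sval (rat_near z))); first by apply/mapP; exists z.
by rewrite /= ltW // (lt_trans zy).
Qed.

End dense_test_functions.

(** * Means over the leaves *)

Section leaf_means.
Local Open Scope ereal_scope.
Context {R : realType} (S : subshift R) (p : 'M[R]_(nsym S)) (q : 'rV[R]_(nsym S)).
Local Notation X := (shift_space S).
Variable m : probability (borel X) R.
Hypothesis hm : markov_measure p q m.
Context (K : pmetricType R).
Variables (G : skew_space S K -> borel K) (alpha H : R).
Local Notation F := (skew G).
Local Notation Y n x y := ((iter n F (x, y)).2 : K).
Hypothesis mG : measurable_fun setT G.
Variable mu0 : probability (skew_space S K) R.
Hypothesis inv : invariant_measure G mu0.
Hypothesis base : forall E : set (borel X), measurable E -> mu0 (fst @^-1` E) = m E.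
Variable leaf : borel X -> probability (skew_space S K) R.
Hypothesis mleaf : forall E, measurable E -> measurable_fun [set: borel X] (leaf ^~ E).
Hypothesis leaf_supp : {ae m, forall x, leaf x [set z | z.1 = x] = 1}.
Hypothesis mu0E : forall E, measurable E -> mu0 E = \int[m]_x leaf x E.

Definition leaf_mean (h : K -> R) (x : X) : \bar R := \int[leaf x]_z (h z.2)%:E.

Lemma leaf_mean_ge0 h x : (forall y, 0 <= h y)%R -> 0 <= leaf_mean h x.
Proof. by move=> h0; apply: integral_ge0 => z _; rewrite lee_fin. Qed.

Let measurable_snd_comp (h : borel K -> R) : measurable_fun [set: borel K] h ->
  measurable_fun [set: skew_space S K] (fun z => (h z.2)%:E).
Proof. by move=> mh; apply/measurable_EFinP; apply: measurableT_comp mh _. Qed.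

Lemma measurable_leaf_mean (h : K -> R) :
  measurable_fun [set: borel K] (h : borel K -> R) ->
  (forall y, 0 <= h y)%R -> measurable_fun [set: borel X] (leaf_mean h).
Proof.
move=> mh h0; apply: (@measurable_fun_integral_kernel _ _ _ _ _ leaf) => //.
  by move=> z; rewrite lee_fin.
exact: measurable_snd_comp.
Qed.

Let measurable_fst_preimage (E : set (borel X)) : measurable E ->
  measurable (fst @^-1` E : set (skew_space S K)).
Proof. by move=> mE; rewrite -[_ @^-1` _]setTI; exact: measurable_fst. Qed.

Let measurable_shift_preimage n (E : set (borel X)) : measurable E ->
  measurable (iter n (@shift R S) @^-1` E : set (borel X)).
Proof.
elim: n E => [//|n IH] E mE.
by apply: (IH (@shift R S @^-1` E)); rewrite -[_ @^-1` _]setTI; exact: measurable_shift.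
Qed.

Lemma leaf_meanD_cst (h : K -> R) a x :
  measurable_fun [set: borel K] (h : borel K -> R) ->
  (forall y, 0 <= h y)%R -> (0 <= a)%R ->
  leaf_mean (fun y => h y + a)%R x = leaf_mean h x + a%:E.
Proof.
move=> mh h0 a0; rewrite /leaf_mean.
under eq_integral do rewrite EFinD.
rewrite ge0_integralD //.
- by rewrite integral_cst // [X in _ * X](probability_setT (leaf x)) mule1.
- by move=> z _; rewrite lee_fin.
- exact: measurable_snd_comp.
Qed.

Lemma le_leaf_mean (h1 h2 : K -> R) x :
  measurable_fun [set: borel K] (h1 : borel K -> R) ->
  measurable_fun [set: borel K] (h2 : borel K -> R) ->
  (forall y, 0 <= h1 y)%R -> (forall y, h1 y <= h2 y)%R ->
  leaf_mean h1 x <= leaf_mean h2 x.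
Proof.
move=> m1 m2 h0 h12; apply: ge0_le_integral => //.
- by move=> z _; rewrite lee_fin.
- exact: measurable_snd_comp.
- exact: measurable_snd_comp.
- by move=> z _; rewrite lee_fin.
Qed.

Lemma leaf_mean_le_cst (h : K -> R) x M :
  measurable_fun [set: borel K] (h : borel K -> R) ->
  (forall y, 0 <= h y)%R -> (forall y, h y <= M)%R -> leaf_mean h x <= M%:E.
Proof.
move=> mh h0 hM; apply: (le_trans (le_leaf_mean x mh _ h0 hM)) => //.
by rewrite /leaf_mean integral_cst // [X in _ * X](probability_setT (leaf x)) mule1.
Qed.

(** Almost every leaf measure lives on its own leaf, so restricting the base
    point to [E] amounts to restricting the leaf to [E]. *)
Lemma integral_leaf_mean (h : K -> R) (E : set (borel X)) :
  measurable_fun [set: borel K] (h : borel K -> R) ->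
  (forall y, 0 <= h y)%R -> measurable E ->
  \int[m]_(x in E) leaf_mean h x = \int[mu0]_(z in fst @^-1` E) (h z.2)%:E.
Proof.
move=> mh h0 mE.
have mf := measurable_fst_preimage mE.
pose f : skew_space S K -> \bar R := (fun z => (h z.2)%:E) \_ (fst @^-1` E).
have mff : measurable_fun setT f.
  by apply/(measurable_restrictT _ _).1 => //; apply: measurable_funTS; exact: measurable_snd_comp.
have f0 z : 0 <= f z by rewrite /f patchE; case: ifP => //; rewrite lee_fin.
rewrite [RHS]integral_mkcond -/f.
rewrite (@integral_mixture _ _ _ _ _ m (fun x => leaf x : subprobability (skew_space S K) R) mu0 f) //.
rewrite integral_mkcond; apply: ge0_ae_eq_integral => //.
- by apply/(measurable_restrictT _ _).1 => //; apply: measurable_funTS; exact: measurable_leaf_mean.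
- exact: (@measurable_fun_integral_kernel _ _ _ _ _ leaf).
- by move=> x _; rewrite patchE; case: ifP => // _; exact: leaf_mean_ge0.
- by move=> x _; exact: integral_ge0.
apply: ae_mono leaf_supp => x lx _; rewrite patchE.
have mx : measurable [set z : skew_space S K | z.1 = x].
  exact: (measurable_fst_preimage (measurable_point _)).
have ae1 : {ae leaf x, forall z, z.1 = x}.
  exists (~` [set z : skew_space S K | z.1 = x]); split => //.
    exact: measurableC.
  by rewrite probability_setC // lx subee.
case: ifPn => xE.
  apply: ge0_ae_eq_integral => //.
  - exact: measurable_snd_comp.
  - by move=> z _; rewrite lee_fin.
  apply: ae_mono ae1 => z zx _; rewrite /f patchE mem_set //= zx.
  exact: set_mem.
apply/esym; transitivity (\int[leaf x]_z (cst 0 : skew_space S K -> \bar R) z).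
  apply: ge0_ae_eq_integral => //.
  apply: ae_mono ae1 => z zx _; rewrite /f patchE memNset //= zx.
  by move=> /mem_set Ex; rewrite Ex in xE.
by rewrite integral0.
Qed.

Lemma iter_invariant n (E : set (skew_space S K)) : measurable E ->
  mu0 (iter n F @^-1` E) = mu0 E.
Proof.
elim: n E => [//|n IH] E mE.
have mFE : measurable (F @^-1` E).
  by rewrite -[_ @^-1` _]setTI; exact: (measurable_iter_skew 1 mG).
by rewrite -[RHS](inv mE) -[RHS](IH _ mFE).
Qed.

(** Invariance moves the integral [n] steps forward along the dynamics. *)
Lemma integral_leaf_mean_iter n (h : K -> R) (E : set (borel X)) :
  measurable_fun [set: borel K] (h : borel K -> R) ->
  (forall y, 0 <= h y)%R -> measurable E ->
  \int[m]_(x in E) leaf_mean h x =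
  \int[mu0]_(z in fst @^-1` (iter n (@shift R S) @^-1` E)) (h (Y n z.1 z.2))%:E.
Proof.
move=> mh h0 mE; rewrite integral_leaf_mean //.
have mFn := measurable_iter_skew n mG.
rewrite -(@eq_measure_integral _ _ _ _ mu0 (pushforward mu0 (iter n F))); last first.
  by move=> A mA _; exact: iter_invariant.
rewrite ge0_integral_pushforward //; first last.
- by move=> z _; rewrite lee_fin.
- by apply: measurable_funTS; exact: measurable_snd_comp.
- exact: measurable_fst_preimage.
congr (integral _ _ _); last by apply/funext => -[].
by apply/seteqP; split => z /=; rewrite iter_skew1.
Qed.

Lemma integral_base (E : set (borel X)) (v : X -> R) :
  measurable_fun [set: borel X] (v : borel X -> R) ->
  (forall x, 0 <= v x)%R -> measurable E ->
  \int[m]_(x in E) (v x)%:E = \int[mu0]_(z in fst @^-1` E) (v z.1)%:E.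
Proof.
move=> mv v0 mE.
rewrite -(@eq_measure_integral _ _ _ _ m (pushforward mu0 fst)); last first.
  by move=> A mA _; exact: base.
rewrite ge0_integral_pushforward //.
- by apply: measurable_funTS; exact/measurable_EFinP.
- by move=> z _; rewrite lee_fin.
Qed.

Hypothesis alpha_ge0 : (0 <= alpha)%R.
Hypothesis alpha_le1 : (alpha <= 1)%R.
Hypothesis H_ge0 : (0 <= H)%R.
Hypothesis G_fibre : forall (x : X) (y1 y2 : K),
  (mdist (G (x, y1) : K) (G (x, y2)) <= alpha * mdist y1 y2)%R.
Hypothesis G_base : forall (x1 x2 : X) (y : K),
  (mdist (G (x1, y) : K) (G (x2, y)) <= H * mdist x1 x2)%R.
Hypothesis K_diam : forall y1 y2 : K, (mdist y1 y2 <= 1)%R.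
Variable y0 : K.

(** The mean of [h] on the leaf through [x] is approximated by averaging, over
    the pasts of [x] of length [n], the value of [h] at the image of the single
    point [y0]: the whole fibre is contracted to within [alpha ^+ n]. *)
Definition past_mean n (h : K -> R) (x : X) : R :=
  iter n (transfer p q) (fun x => h (Y n x y0)) x.

Section test_function.
Variable h : K -> R.
Hypothesis h_lip : forall y1 y2, (`|h y1 - h y2| <= mdist y1 y2)%R.
Hypothesis h_ge0 : forall y, (0 <= h y)%R.

Let mh : measurable_fun [set: borel K] (h : borel K -> R).
Proof. by apply: (measurable_lipschitz (L := 1)) => x y; rewrite mul1r. Qed.

Let u n (x : X) : R := h (Y n x y0).

(* The Lipschitz constant of [u n] along the base; the factor [theta ^- n] is
   what [n] applications of the transfer operator remove. *)
Let c n : R := (H / (1 - theta S) / theta S ^+ n)%R.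

Let c_ge0 n : (0 <= c n)%R.
Proof.
have t0 := theta_gt0 S; have t1 := theta_lt1 S.
by rewrite !divr_ge0 ?exprn_ge0 // ?subr_ge0 ltW.
Qed.

Let u_loclip n : loclip (c n) (u n).
Proof.
move=> x y _; apply: (le_trans (h_lip _ _)).
have t0 : (0 < theta S ^+ n)%R by rewrite exprn_gt0 // theta_gt0.
rewrite /c mulrAC ler_pdivlMr // [leLHS]mulrC.
exact: (iter_skew_base alpha_le1 G_fibre G_base).
Qed.

(** The bound is uniform in [n]: the transfer operator contracts at least as
    fast as the forward dynamics expands the base. *)
Lemma past_mean_loclip n : loclip (H / (1 - theta S)) (past_mean n h).
Proof.
have := loclip_iter_transfer hm n (u_loclip n).
by rewrite /c divfK // expf_neq0 // gt_eqF // theta_gt0.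
Qed.

Let u_close n (x : X) (y : K) : (`|h (Y n x y) - u n x| <= alpha ^+ n)%R.
Proof.
apply: (le_trans (h_lip _ _)); apply: (le_trans (iter_skew_fibre alpha_ge0 G_fibre _ _ _ _)).
by rewrite ler_piMr ?exprn_ge0.
Qed.

Let an_ge0 n : (0 <= alpha ^+ n)%R. Proof. exact: exprn_ge0. Qed.

Let mu n : measurable_fun [set: borel X] (u n : borel X -> R).
Proof. exact: measurable_loclip (u_loclip n). Qed.

Let mpast n : measurable_fun [set: borel X] (past_mean n h : borel X -> R).
Proof.
apply: measurable_loclip (past_mean_loclip n).
by rewrite divr_ge0 // subr_ge0 ltW // theta_lt1.
Qed.

Let past_ge0 n x : (0 <= past_mean n h x)%R.
Proof. by apply: (iter_transfer_ge0 hm) => ?; exact: h_ge0. Qed.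

Let mhY n : measurable_fun [set: skew_space S K] (fun z => (h (Y n z.1 z.2))%:E).
Proof.
apply/measurable_EFinP.
rewrite (_ : (fun z => _) = h \o snd \o iter n F); last by apply/funext => -[].
apply: (@measurableT_comp _ _ _ _ _ _ (h \o snd : skew_space S K -> R)).
  by have /measurable_EFinP := measurable_snd_comp mh.
exact: measurable_iter_skew.
Qed.

Let mufst n a : measurable_fun [set: skew_space S K] (fun z => (u n z.1 + a)%:E).
Proof.
apply/measurable_EFinP; apply: measurable_funD => //.
exact: (@measurableT_comp _ _ _ _ _ _ (u n : borel X -> R)).
Qed.

Let integral_past n a (E : set (borel X)) : (0 <= a)%R -> measurable E ->
  \int[m]_(x in E) (past_mean n h x + a)%:E =
  \int[mu0]_(z in fst @^-1` (iter n (@shift R S) @^-1` E)) (u n z.1 + a)%:E.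
Proof.
move=> a0 mE; pose v (x : X) := (u n x + a)%R.
have vc : loclip (c n) v.
  by move=> x y xy; rewrite /v opprD addrACA subrr addr0; exact: u_loclip.
have v0 x : (0 <= v x)%R by rewrite addr_ge0 // /u.
transitivity (\int[m]_(x in E) (iter n (transfer p q) v x)%:E).
  by apply: eq_integral => x _; rewrite (iter_transferD_cst hm).
rewrite -(integral_iter_transfer hm n (c_ge0 n)) // (@integral_base _ v) //.
- exact: measurable_loclip vc.
- exact: measurable_shift_preimage.
Qed.

Let h_le y : (h y <= h y0 + 1)%R.
Proof.
rewrite -lerBlDl (le_trans (ler_norm _)) // (le_trans (h_lip _ _)) //.
Qed.

Let integral_le_cst d (T : measurableType d) (nu : probability T R) (f : T -> \bar R) D M :
  measurable D -> measurable_fun D f -> (forall x, 0 <= f x) -> (0 <= M)%R ->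
  (forall x, f x <= M%:E) -> \int[nu]_(x in D) f x < +oo.
Proof.
move=> mD mf f0 M0 fM.
apply: (@le_lt_trans _ _ (\int[nu]_(x in D) (cst M%:E) x)); first exact: ge0_le_integral.
rewrite integral_cst // (le_lt_trans (lee_wpmul2l _ (probability_le1 nu mD))) //.
by rewrite mule1 ltry.
Qed.

Let measurable_past_domain n (E : set (borel X)) : measurable E ->
  measurable (fst @^-1` (iter n (@shift R S) @^-1` E) : set (skew_space S K)).
Proof. by move=> mE; apply: measurable_fst_preimage; exact: measurable_shift_preimage. Qed.

(** Integrated over any base set [E], the two sides are integrals over the same
    subset of the skew product of [h] at two points of the same leaf that are
    within [alpha ^+ n]. *)
Lemma leaf_mean_le_past n :
  {ae m, forall x, leaf_mean h x <= (past_mean n h x + alpha ^+ n)%:E}.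
Proof.
apply: ae_le_of_integral_le.
- exact: measurable_leaf_mean.
- by apply/measurable_EFinP; exact: measurable_funD.
- by move=> x; exact: leaf_mean_ge0.
- by move=> x; rewrite lee_fin addr_ge0.
- rewrite integral_past //; apply: (@integral_le_cst _ _ _ _ _ (h y0 + 1 + alpha ^+ n)%R).
  + exact: measurable_past_domain.
  + by apply: measurable_funTS; exact: mufst.
  + by move=> z; rewrite lee_fin addr_ge0 // /u.
  + by rewrite !addr_ge0.
  + by move=> z; rewrite lee_fin lerD2r; exact: h_le.
move=> E mE; rewrite (integral_leaf_mean_iter n) // integral_past //.
apply: ge0_le_integral.
- exact: measurable_past_domain.
- by move=> z _; rewrite lee_fin.
- exact: measurable_funTS.
- by apply: measurable_funTS; exact: mufst.
move=> [x y] _; rewrite lee_fin -lerBlDl /=.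
by apply: le_trans (u_close n x y); exact: ler_norm.
Qed.

Lemma past_le_leaf_mean n :
  {ae m, forall x, (past_mean n h x)%:E <= leaf_mean h x + (alpha ^+ n)%:E}.
Proof.
pose g y := (h y + alpha ^+ n)%R.
have mg : measurable_fun [set: borel K] (g : borel K -> R) by exact: measurable_funD.
have g0 y : (0 <= g y)%R by rewrite addr_ge0.
have : {ae m, forall x, (past_mean n h x)%:E <= leaf_mean g x}.
  apply: ae_le_of_integral_le.
  - exact/measurable_EFinP.
  - exact: measurable_leaf_mean.
  - by move=> x; rewrite lee_fin.
  - by move=> x; exact: leaf_mean_ge0.
  - apply: (@integral_le_cst _ _ _ _ _ (h y0 + 1 + alpha ^+ n)%R) => //.
    + exact: measurable_leaf_mean.
    + by move=> x; exact: leaf_mean_ge0.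
    + by rewrite !addr_ge0.
    + by move=> x; apply: leaf_mean_le_cst => // y; rewrite lerD2r; exact: h_le.
  move=> E mE; rewrite (integral_leaf_mean_iter n) //.
  under eq_integral do rewrite -[past_mean _ _ _]addr0.
  rewrite integral_past //; apply: ge0_le_integral.
  - exact: measurable_past_domain.
  - by move=> z _; rewrite lee_fin addr0 /u.
  - by apply: measurable_funTS; exact: mufst.
  - apply: measurable_funTS; under eq_fun do rewrite /g EFinD.
    exact: emeasurable_funD.
  move=> [x y] _; rewrite lee_fin addr0 -lerBlDl /=.
  by apply: le_trans (u_close n x y); rewrite distrC; exact: ler_norm.
by apply: ae_mono => x /le_trans; apply; rewrite leaf_meanD_cst.
Qed.

End test_function.

Hypothesis K_compact : compact [set: K].
Hypothesis alpha_lt1 : (alpha < 1)%R.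

(** The shift makes the integrals nonnegative; it cancels in the difference of
    two means. *)
Let up (g : K -> R) y := (g y + 1)%R.

Let Wtest_up g : Wtest g ->
  [/\ (forall y1 y2, `|up g y1 - up g y2| <= mdist y1 y2)%R,
      (forall y, 0 <= up g y)%R, (forall y, up g y <= 2)%R &
      measurable_fun [set: borel K] (up g : borel K -> R)].
Proof.
move=> [gl g1]; have ul y1 y2 : (`|up g y1 - up g y2| <= mdist y1 y2)%R.
  by rewrite /up opprD addrACA subrr addr0.
split => //.
- by move=> y; rewrite /up -lerBlDr sub0r; have := g1 y; rewrite ler_norml => /andP[].
- by move=> y; rewrite /up; have := g1 y; rewrite ler_norml => /andP[_]; lra.
- by apply: (measurable_lipschitz (L := 1)) => x y; rewrite mul1r.
Qed.

Definition rleaf_mean (g : K -> R) (x : X) : R := fine (leaf_mean (up g) x).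

Lemma leaf_meanE g x : Wtest g -> leaf_mean (up g) x = (rleaf_mean g x)%:E.
Proof.
move=> /Wtest_up[_ g0 g2 mg]; rewrite /rleaf_mean fineK // ge0_fin_numE.
  by rewrite (le_lt_trans (leaf_mean_le_cst x mg g0 g2)) // ltry.
exact: leaf_mean_ge0.
Qed.

Lemma rleaf_mean_bound g x : Wtest g -> (0 <= rleaf_mean g x <= 2)%R.
Proof.
move=> gW; have [_ g0 g2 mg] := Wtest_up gW.
rewrite -!lee_fin -leaf_meanE // leaf_mean_ge0 //=; exact: leaf_mean_le_cst.
Qed.

Lemma rleaf_mean_close g1 g2 e x : Wtest g1 -> Wtest g2 -> (0 <= e)%R ->
  (forall y, `|g1 y - g2 y| <= e)%R -> (rleaf_mean g1 x <= rleaf_mean g2 x + e)%R.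
Proof.
move=> w1 w2 e0 g12; have [_ p1 _ m1] := Wtest_up w1; have [_ p2 _ m2] := Wtest_up w2.
rewrite -lee_fin EFinD -!leaf_meanE // -leaf_meanD_cst //.
apply: le_leaf_mean => //; first exact: measurable_funD.
by move=> y; rewrite /up; have := g12 y; rewrite ler_norml => /andP[_]; lra.
Qed.

(** Outside a null set that does not depend on the test function, thanks to
    the countable dense family, the leaf means are Lipschitz: on a
    one-cylinder as limits of the past means, across cylinders because the
    distance is then at least 1. *)
Lemma leaf_mean_ae_lipschitz : exists2 good : X -> Prop,
  {ae m, forall x, good x} &
  forall x1 x2 g, good x1 -> good x2 -> Wtest g ->
    (`|rleaf_mean g x1 - rleaf_mean g x2| <= (2 + H) / (1 - theta S) * mdist x1 x2)%R.
Proof.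
have t0 := theta_gt0 S; have t1 := theta_lt1 S.
have c0 : (0 < 1 - theta S)%R by rewrite subr_gt0.
have [h [hW hdense]] := dense_Wtest K_compact.
pose B : R := (H / (1 - theta S))%R.
have B0 : (0 <= B)%R by rewrite divr_ge0 // ltW.
exists (fun x => forall j n,
    (rleaf_mean (h j) x <= past_mean n (up (h j)) x + alpha ^+ n)%R /\
    (past_mean n (up (h j)) x <= rleaf_mean (h j) x + alpha ^+ n)%R).
  apply: ae_foralln => j; apply: ae_foralln => n.
  have [hl h0 _ _] := Wtest_up (hW j).
  apply: ae_mono2 (leaf_mean_le_past hl h0 n) (past_le_leaf_mean hl h0 n) => x.
  by rewrite leaf_meanE // -EFinD !lee_fin.
have half x1 x2 g : (forall j n,
      (rleaf_mean (h j) x1 <= past_mean n (up (h j)) x1 + alpha ^+ n)%R /\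
      (past_mean n (up (h j)) x1 <= rleaf_mean (h j) x1 + alpha ^+ n)%R) ->
    (forall j n,
      (rleaf_mean (h j) x2 <= past_mean n (up (h j)) x2 + alpha ^+ n)%R /\
      (past_mean n (up (h j)) x2 <= rleaf_mean (h j) x2 + alpha ^+ n)%R) ->
    Wtest g -> x1 0%N = x2 0%N ->
    (rleaf_mean g x1 - rleaf_mean g x2 <= B * mdist x1 x2)%R.
  move=> good1 good2 gW x12; apply/ler_addgt0Pr => e e0.
  have e2 : (0 < e / 2)%R by rewrite divr_gt0.
  have [j gj] := hdense g gW _ e2.
  apply: (@le_of_geometric _ _ _ 2 alpha) => // n.
  have jg y : (`|h j y - g y| <= e / 2)%R by rewrite distrC.
  have a1 := rleaf_mean_close x1 gW (hW j) (ltW e2) gj.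
  have a2 := rleaf_mean_close x2 (hW j) gW (ltW e2) jg.
  have [b1 _] := good1 j n; have [_ b2] := good2 j n.
  have [hl h0 _ _] := Wtest_up (hW j).
  have := past_mean_loclip hl n x12; rewrite ler_norml => /andP[_ b3].
  rewrite -/B in b3; lra.
move=> x1 x2 g good1 good2 gW; have d0 := mdist_ge0 x1 x2.
have C2 : (2 <= (2 + H) / (1 - theta S))%R by rewrite ler_pdivlMr //; have h0 := H_ge0; lra.
have CB : (B <= (2 + H) / (1 - theta S))%R.
  by rewrite /B ler_pM2r ?invr_gt0 // lerDr.
case: (eqVneq (x1 0%N) (x2 0%N)) => [x12|/mdist_ge1 d1].
  apply: (@le_trans _ _ (B * mdist x1 x2)%R); last by rewrite ler_wpM2r.
  rewrite ler_norml lerNl opprB half // andbT metric_sym.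
  exact: half.
have /andP[l1 u1] := rleaf_mean_bound x1 gW; have /andP[l2 u2] := rleaf_mean_bound x2 gW.
apply: (@le_trans _ _ 2%R); first by rewrite ler_norml; apply/andP; split; lra.
by apply: (le_trans C2); rewrite ler_peMr // (le_trans _ C2).
Qed.

End leaf_means.

(** * The invariant measure *)

Section disintegrations.
Local Open Scope ereal_scope.
Context {R : realType} (S : subshift R) (K : pmetricType R).
Local Notation X := (shift_space S).
Variable m : probability (borel X) R.
Variable mu0 : probability (skew_space S K) R.

Lemma disintegration_of_charge_pos :
  disintegration m (charge_pos (charge_of_finite_measure mu0)) ->
  disintegration m mu0.
Proof.
move=> [phi leaf mphi phi0 dphi mleaf supp dE].
apply: (@Disintegration _ _ _ _ _ phi leaf) => //.
- move=> E mE; rewrite -dphi // /pushforward charge_pos_of_measure //.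
  by rewrite -[_ @^-1` _]setTI; exact: measurable_fst.
- by move=> E mE; rewrite -dE // charge_pos_of_measure.
Qed.

(** Finiteness of the norm of [mu0] says in particular that [mu0] has a
    disintegration: the infimum defining it is not over the empty set. *)
Lemma Sinfty_disintegration : Sinfty m (charge_of_finite_measure mu0) ->
  exists w : disintegration m mu0, True.
Proof.
move=> [[_ noo] _]; apply: contrapT => nw; move: noo.
rewrite /norm_infty (_ : [set _ | _ in _ & _ in _] = set0) ?ereal_inf0 ?ltxx //.
apply/seteqP; split => // z [wp wpT zE]; exfalso; apply: nw.
by exists (disintegration_of_charge_pos wp).
Qed.

(** Where the density is 1, the leaf restrictions are probabilities: the norm
    of their difference can be read off the means of shifted test functions. *)
Lemma Wnorm_leaf_le (w : disintegration m mu0) (x1 x2 : X) (c : R) :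
  dis_phi w x1 = 1%R -> dis_phi w x2 = 1%R ->
  (forall g : K -> R, Wtest g ->
     `|rleaf_mean (dis_leaf w) g x1 - rleaf_mean (dis_leaf w) g x2| <= c)%R ->
  Wnorm (charge_sub (leaf_restr w x1) (leaf_restr w x2)) <= c%:E.
Proof.
move=> phi1 phi2 gc; apply: ge_ereal_sup => _ [g gW <-].
have msnd : measurable_fun [set: skew_space S K] (snd : skew_space S K -> borel K).
  exact: measurable_snd.
have [gl g1] := gW.
have mg : measurable_fun [set: borel K] (g : borel K -> R).
  by apply: (measurable_lipschitz (L := 1)) => x y; rewrite mul1r.
pose n (x : X) : subprobability (borel K) R :=
  giry_map msnd (dis_leaf w x : subprobability (skew_space S K) R).
rewrite (@charge_integral_sub _ _ _ _ (n x1) (n x2)) //; first last.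
- move=> A mA; rewrite /charge_sub /leaf_restr /cadd /copp /= /cscale /=.
  by rewrite [LHS]/cadd /= phi1 phi2; congr (_ - _); exact: mul1e.
- exact: (etrans (probability_setT (dis_leaf w x1))
                 (esym (probability_setT (dis_leaf w x2)))).
have int x : \int[n x]_y (g y + 1)%:E = leaf_mean (dis_leaf w) (fun y => g y + 1)%R x.
  rewrite /leaf_mean [LHS](giry_int_map msnd) //.
  - by apply/measurable_EFinP; exact: measurable_funD.
  - by move=> y; rewrite lee_fin -lerBlDr sub0r; have := g1 y; rewrite ler_norml => /andP[].
rewrite !int !leaf_meanE // -EFinB /= lee_fin; exact: gc.
Qed.

End disintegrations.

Section invariant_marginal.
Local Open Scope ereal_scope.
Context {R : realType} (S : subshift R) (p : 'M[R]_(nsym S)) (q : 'rV[R]_(nsym S)).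
Local Notation X := (shift_space S).
Variable m : probability (borel X) R.
Hypothesis hm : markov_measure p q m.
Context (K : pmetricType R).
Variables (G : skew_space S K -> borel K) (mu0 : probability (skew_space S K) R).

(** The base marginal is shift-invariant and has a Lipschitz density, hence it
    is the Markov measure itself. *)
Lemma invariant_marginal (w : disintegration m mu0) (phi : X -> R) :
  invariant_measure G mu0 -> Ftheta phi -> base_density m mu0 phi ->
  {ae m, forall x, dis_phi w x = 1%R} /\
  forall E : set (borel X), measurable E -> mu0 (fst @^-1` E) = m E.
Proof.
move=> inv phiF dphi; have [L phiL] := phiF.
have mphi : measurable_fun [set: borel X] (phi : borel X -> R).
  exact: measurable_lipschitz phiL.
have int1 : \int[m]_x (dis_phi w x)%:E = 1.
  by rewrite -(dis_phi_density w) // /pushforward preimage_setT [LHS](probability_setT mu0).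
have aeE : {ae m, forall x, dis_phi w x = phi x}.
  have : ae_eq m setT (fun x => (dis_phi w x)%:E) (fun x => (phi x)%:E).
    apply: integral_ae_eq => //.
    - apply/integrableP; split; first by apply/measurable_EFinP; exact: dis_phi_measurable.
      under eq_integral do rewrite gee0_abs ?lee_fin ?dis_phi_ge0 //.
      by rewrite int1 ltry.
    - exact/measurable_EFinP.
    - by move=> E _ mE; rewrite -dphi // (dis_phi_density w).
  by apply: ae_mono => x /(_ I) [].
have phi1 : forall x, phi x = 1%R.
  apply: (invariant_density_eq1 hm phiF).
  - by apply: ae_mono aeE => x <-; exact: dis_phi_ge0.
  - by rewrite -dphi // /pushforward preimage_setT [LHS](probability_setT mu0).
  - move=> E mE; have mfE : measurable (fst @^-1` E : set (skew_space S K)).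
      by rewrite -[_ @^-1` _]setTI; exact: measurable_fst.
    rewrite -!dphi //; first exact: (inv _ mfE).
    by rewrite -[_ @^-1` _]setTI; exact: measurable_shift.
split; first by apply: ae_mono aeE => x ->.
move=> E mE; rewrite [LHS](dphi E mE).
under eq_integral do rewrite phi1.
by rewrite integral_cst // mul1e.
Qed.

End invariant_marginal.

Section fibre_contraction_everywhere.
Context {R : realType} (S : subshift R) (p : 'M[R]_(nsym S)) (q : 'rV[R]_(nsym S)).
Local Notation X := (shift_space S).
Variable m : probability (borel X) R.
Hypothesis hm : markov_measure p q m.

(** The Markov measure charges every ball and [G] is continuous along the
    base, so the almost sure contraction holds on every fibre. *)
Lemma fibre_contraction_everywhere (K : pmetricType R)
    (G : skew_space S K -> borel K) (alpha : R) (k : K -> R) :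
  0 <= alpha -> fibre_contraction m G alpha -> base_lipschitz G k ->
  forall (x : X) (y1 y2 : K),
    mdist (G (x, y1) : K) (G (x, y2)) <= alpha * mdist y1 y2.
Proof.
move=> a0 fc bl x y1 y2; apply/ler_addgt0Pr => e e0.
have [k1 L1] := bl y1; have [k2 L2] := bl y2.
have c1 : 0 < k y1 + k y2 + 1 by rewrite ltr_wpDl // addr_ge0.
have [x' fx'] := ae_dense hm fc x (e := e / (k y1 + k y2 + 1)) ltac:(by rewrite divr_gt0).
rewrite ltr_pdivlMr // => xx'.
have d0 := mdist_ge0 x x'.
have := metric_triangle (G (x, y1) : K) (G (x', y1)) (G (x, y2)).
have := metric_triangle (G (x', y1) : K) (G (x', y2)) (G (x, y2)).
have := L1 x x'; have := L2 x' x; have := fx' y1 y2; rewrite (metric_sym x' x); nra.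
Qed.

End fibre_contraction_everywhere.

Theorem theorem3 (R : realType) (S : subshift R)
    (p : 'M[R]_(nsym S)) (q : 'rV[R]_(nsym S))
    (m : probability (borel (shift_space S)) R)
    (hm : markov_measure p q m) (H : R) :
  exists2 C1 : R, 0 < C1 &
    forall (K : pmetricType R),
      compact [set: K] -> diam K = 1 ->
    forall (G : skew_space S K -> borel K),
      measurable_fun [set: skew_space S K] G ->
    forall alpha : R, 0 < alpha -> alpha < 1 -> fibre_contraction m G alpha ->
    forall k : K -> R, base_lipschitz G k ->
      has_ubound (range k) -> sup (range k) = H ->
    forall mu0 : probability (skew_space S K) R,
      invariant_measure G mu0 ->
      Sinfty m (charge_of_finite_measure mu0) ->
      Ltheta_pos m (charge_of_finite_measure mu0) /\
      (lip_theta m mu0 <= (C1 / (1 - theta S))%:E)%E.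
Proof.
exists (2 + `|H|); first by rewrite ltr_wpDr.
move=> K cK dK G mG alpha a0 a1 fc k bl ubk supk mu0 inv Sinf.
have t1 := theta_lt1 S.
suff bound : (lip_theta m mu0 <= ((2 + `|H|) / (1 - theta S))%:E)%E.
  split => //; split; first by case: Sinf => -[].
    by move=> E mE; exact: measure_ge0.
  exact: le_lt_trans bound (ltry _).
have kH y : k y <= H by rewrite -supk; apply: ub_le_sup => //; exists y.
have H0 : 0 <= H by apply: le_trans (kH point); case: (bl point).
rewrite ger0_norm //.
have [_ [phi phiF dphi]] := Sinf.
have [w _] := Sinfty_disintegration Sinf.
have [phi1 base] := invariant_marginal hm w inv phiF dphi.
have G_fibre := fibre_contraction_everywhere hm (ltW a0) fc bl.
have G_base (x1 x2 : shift_space S) (y : K) :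
    mdist (G (x1, y) : K) (G (x2, y)) <= H * mdist x1 x2.
  have [_ b] := bl y; apply: (le_trans (b x1 x2)).
  by rewrite ler_wpM2r ?mdist_ge0.
have K_diam (y1 y2 : K) : mdist y1 y2 <= 1.
  rewrite -dK; apply: ub_le_sup; last by exists y1 => //; exists y2.
  (* the supremum of an unbounded set is 0 by convention *)
  apply: contrapT => nub; move: dK; rewrite /diam sup_out => [/eqP|[_ //]].
  by rewrite eq_sym oner_eq0.
have mu0E (E : set (skew_space S K)) : measurable E ->
    (mu0 E = \int[m]_x dis_leaf w x E)%E.
  move=> mE; rewrite (disE w) //; apply: ge0_ae_eq_integral => //.
  - apply: emeasurable_funM; first exact: dis_leaf_measurable.
    by apply/measurable_EFinP; exact: dis_phi_measurable.
  - exact: dis_leaf_measurable.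
  - by move=> x _; rewrite mule_ge0 // lee_fin dis_phi_ge0.
  - by apply: ae_mono phi1 => x -> _; rewrite mule1.
have supp : {ae m, forall x, dis_leaf w x [set z | z.1 = x] = 1%E}.
  by apply: ae_mono2 phi1 (dis_leaf_supp w) => x -> ; apply; exact: oner_neq0.
have [good aegood lip] := leaf_mean_ae_lipschitz hm mG inv base
  (dis_leaf_measurable w) supp mu0E (ltW a0) (ltW a1) H0 G_fibre G_base K_diam point cK a1.
have [N [mN N0 goodN]] : {ae m, forall x, good x /\ dis_phi w x = 1}.
  exact: ae_mono2 aegood phi1.
apply: (@le_trans _ _ (path_lip w)); first by apply: ereal_inf_lbound; exists w.
apply/ess_supP; exists ((N `*` setT) `|` (setT `*` N)); split.
- by apply: measurableU; apply: measurableX.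
- apply/eqP; rewrite -measure_le0; apply: (le_trans (measureU2 _ _ _)).
  + exact: measurableX.
  + exact: measurableX.
  + rewrite [X in (X + _)%E](product_measure1E m m mN measurableT).
    rewrite [X in (_ + X)%E](product_measure1E m m measurableT mN).
    by rewrite [X in (X * _ + _)%E]N0 [X in (_ + _ * X)%E]N0 mule0 mul0e adde0.
move=> [x1 x2] /=; apply: contra_notP => /not_orP[/= n1 n2].
have [good1 phi11] : good x1 /\ dis_phi w x1 = 1.
  by apply: contrapT => n; apply: n1; split => //; exact: goodN.
have [good2 phi12] : good x2 /\ dis_phi w x2 = 1.
  by apply: contrapT => n; apply: n2; split => //; exact: goodN.
have Wle := Wnorm_leaf_le phi11 phi12 (fun g gW => lip x1 x2 g good1 good2 gW).
have C0 : 0 <= (2 + H) / (1 - theta S) by rewrite divr_ge0 ?subr_ge0 ?addr_ge0 // ltW.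
case: (eqVneq (mdist (x1 : shift_space S) x2) 0) => [->|d0].
  by rewrite invr0 mule0 lee_fin.
apply: (le_trans (lee_wpmul2r _ Wle)).
  by rewrite lee_fin invr_ge0 mdist_ge0.
by rewrite -EFinM lee_fin mulfK.
Qed.
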